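(* Let $n$ take values only in an infinite set of odd square-free integers greater than $1$ such that \[ \frac{(\log n)^7}{p_n}\to 0 \quad\text{as } n\to\infty, \] where $p_n$ is the smallest prime factor of $n$, and let $r$ be real. Let $J(z)=\sum_{j=1}^{n-1}\left(\frac{j}{n}\right)z^j$ be the character polynomial of degree $n-1$ and let $V$ be drawn uniformly at random from $\mathcal{V}_n$. Then, as $n\to\infty$, \[ F(J_r+V_r)\to f(r)\quad\text{in probability}. \]
   Context: For real $\alpha\ge1$ and $A\in\mathbb{C}[z]$, $\|A\|_\alpha=\left(\frac{1}{2\pi}\int_0^{2\pi}|A(e^{i\theta})|^\alpha d\theta\right)^{1/\alpha}$. The merit factor of $A$ is $F(A)=\frac{\|A\|_2^4}{\|A\|_4^4-\|A\|_2^4}$. For a polynomial $A$ of degree at most $n-1$ and real $r$, the rotation is $A_r(z)=z^{-\lfloor nr\rfloor}A(z)\bmod (z^n-1)$. $\left(\frac{\cdot}{n}\right)$ denotes the Jacobi symbol. $\mathcal{V}_n$ is the set of polynomials $\sum_{j=0}^{n-1}v_jz^j$ with $v_j\in\{0,-1,+1\}$ and $v_j=0$ if and only if $\gcd(j,n)=1$. The function $f$ is $1$-periodic with $f(r)=\dfrac{1}{\frac16+8\left(|r|-\frac14\right)^2}$ for $-\frac12<r\le\frac12$. *)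

(* Defs.v *)
From Stdlib Require Import Reals ZArith.
From Coquelicot Require Import Coquelicot.
From mathcomp Require Import all_boot.
Local Open Scope R_scope.

Set Implicit Arguments.
Unset Strict Implicit.
Unset Printing Implicit Defensive.

Definition squarefree (n : nat) : Prop :=
  forall p, prime p -> ~~ (p * p %| n)%N.

Definition legendre (a p : nat) : Z :=
  if p %| a then 0%Z
  else if [exists x : 'I_p, ((x * x) %% p == a %% p)%N] then 1%Z else (-1)%Z.

Definition jacobi (a n : nat) : Z :=
  foldr (fun pe acc => (legendre a pe.1 ^ Z.of_nat pe.2 * acc)%Z) 1%Z (prime_decomp n).

Definition circ (n : nat) (a : nat -> R) (t : R) : C :=
  foldr Cplus (RtoC 0)
    (map (fun j => ((a j * cos (INR j * t)), (a j * sin (INR j * t)))) (seq.iota 0 n)).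

Definition Lpow (n : nat) (a : nat -> R) (k : nat) : R :=
  (/ (2 * PI) * RInt (fun t => (Cmod (circ n a t)) ^ k) 0 (2 * PI)).

Definition merit (n : nat) (a : nat -> R) : R :=
  ((Lpow n a 2) ^ 2 / (Lpow n a 4 - (Lpow n a 2) ^ 2)).

(* floor of a real, via Stdlib's up (x < up x <= x + 1) *)
Definition Zfloor (x : R) : Z := (up x - 1)%Z.

(* rotation A_r(z) = z^{-floor(n r)} A(z) mod (z^n - 1):
   coefficient k (0 <= k < n) of A_r is a_{(k + floor(n r)) mod n}; zero for k >= n *)
Definition rot (n : nat) (r : R) (a : nat -> R) : nat -> R :=
  fun k => if (k < n)%N then
             a (Z.to_nat (Z.modulo (Z.of_nat k + Zfloor (INR n * r)) (Z.of_nat n)))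
           else 0.

Definition Jcoef (n : nat) (j : nat) : R :=
  if ((0 < j) && (j < n))%N then IZR (jacobi j n) else 0.

Definition code3 (x : 'I_3) : R :=
  if (val x == 0)%N then 0 else if (val x == 1)%N then 1 else (-1).

Definition Vcoef (n : nat) (v : {ffun 'I_n -> 'I_3}) (j : nat) : R :=
  oapp (fun i : 'I_n => code3 (v i)) 0 (insub j).

Definition Vn (n : nat) : {set {ffun 'I_n -> 'I_3}} :=
  [set v : {ffun 'I_n -> 'I_3} | [forall i : 'I_n, ((val (v i) == 0)%N == coprime i n)]].

(* representative of r modulo 1 in (-1/2, 1/2]: r - ceil(r - 1/2) *)
Definition red (r : R) : R := (r - IZR (1 - up (/2 - r))).

Definition f (r : R) : R :=
  (/ (/6 + 8 * (Rabs (red r) - /4) ^ 2)).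

Definition prob_dev (n : nat) (r eps : R) : R :=
  (INR #|[set v in Vn n |
          Rlt_dec eps (Rabs (merit n (fun k => rot n r (Jcoef n) k + rot n r (Vcoef v) k) - f r))]|
   / INR #|Vn n|).

(* Main.v *)
Require Import Defs.
From Stdlib Require Import Reals ZArith Lra.
From Coquelicot Require Import Coquelicot.
From mathcomp Require Import all_boot all_fingroup all_order all_algebra all_solvable.
From mathcomp Require Import complex Rstruct.

(** The coefficients of A = J_r + V_r are signs, so ||A||_2^2 = n, and ||A||_4^4
    is the additive energy T(A), the sum of a_i a_j a_k a_l over i + j = k + l.
    For indices in [0, n) with i + j = k + l mod n, the indicator of
    i + j = k + l is 1 - ((i + j - k - l) / n)^2; hence n T(A) is a combination
    of the sums over the n-th roots of unity of |F|^4, E F conj(F)^2,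
    D^2 conj(F)^2 and |D|^2 |F|^2, where F, D, E are the discrete Fourier
    transforms of a_i, i a_i, i^2 a_i (with i centered).  For the rotated
    Jacobi symbol, F(k) is a Gauss sum: |F(k)|^2 is n if k is prime to n and 0
    otherwise.  Treating |F| as constant thus costs only the contribution of
    the few k not prime to n, where |D| is O(n^(3/2) log n) as in the
    Polya-Vinogradov inequality; every sum is then evaluated by Parseval, and
    T(J_r) / n^2 tends to 5/3 - 2 s (1 - s) with s the fractional part of -2r.
    Finally V_r consists of n - phi(n) = O(n log n / p_n) random signs, so by a
    fourth moment computation and Markov's inequality it changes the energy by
    o(n^2) in probability. *)

Set Implicit Arguments.
Unset Strict Implicit.
Unset Printing Implicit Defensive.
Delimit Scope R_scope with coqR.
Delimit Scope Z_scope with coqZ.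

Local Open Scope R_scope.

(** The energy asks for i + j = k + l in the integers, whereas products of transforms only see it
    modulo n; the indicator bridges the two and, being quadratic, brings in no moment beyond the
    second. The obstacle is the set of k not prime to n, where F vanishes but D and E need not. The
    terms with E are still exact, because a factor F remains beside |F|^2 = n chi^2. The terms with
    D are not: completing their sums to all k leaves a defect, which a pointwise bound on D
    controls. The limit is produced by a reflection. For a shift by r places, conj(F(k))^2 equals
    chi(-1) n z^(2 r k) for k prime to n, free of the phase of the Gauss sum; under Parseval this
    twist couples a with s(a) = - a - 2 r mod n, and the main term of n^2 T is n^4 + 2 n times the
    sum of (a - s(a))^2. Randomness is treated by counting: independence enters only through maps of
    the sample space that flip one sign. *)

Lemma sin_ge_quarter (y : R) : (0 <= y -> y <= PI / 2 -> y / 4 <= sin y)%coqR.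
Proof.
intros y0 y2.
assert (H1 := PI_4). assert (H2 := PI_RGT_0).
destruct (SIN y y0 ltac:(lra)) as [lb _].
apply Rle_trans with (2 := lb).
replace (sin_lb y) with (y * (1 - y^2 / 6 + (y^2)^2 / 120 - (y^2)^3 / 5040)).
 (* [PI_4] gives y <= 2, where the Taylor minorant of degree seven exceeds y / 4. A linear lower
    bound is what the chord lengths need. *)
 assert (0 <= y^2 <= 4) by nra.
 assert (1/4 <= 1 - y^2 / 6 + (y^2)^2 / 120 - (y^2)^3 / 5040) by nra.
 nra.
unfold sin_lb, sin_approx, sin_term. simpl. field.
Qed.

Local Close Scope R_scope.

From mathcomp Require Import ring lra zify.
Import Order.TTheory GRing.Theory Num.Theory.

(** * The Jacobi symbol *)

Lemma primitive_root_modn (p : nat) : prime p -> exists g : nat,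
  [/\ ~~ (p %| g), forall a, ~~ (p %| a) -> exists k, g ^ k = a %[mod p] &
      forall i j, g ^ i = g ^ j %[mod p] -> i = j %[mod p.-1]].
Proof.
move=> p_pr.
have eqF a b : (a%:R == b%:R :> 'F_p)%R = (a == b %[mod p]).
  by rewrite -val_eqE /= !val_Fp_nat.
have /cyclicP[u Gu] := field_unit_group_cyclic [set: {unit 'F_p}].
have ord_u : #[u]%g = p.-1 by rewrite /order -Gu card_finField_unit card_Fp.
pose g : nat := val (val u).
have gE : (g%:R)%R = val u by rewrite /g natr_Zp.
have gX k : ((g ^ k)%:R)%R = val (u ^+ k)%g by rewrite natrX gE FinRing.val_unitX.
have dvdF a : (p %| a) = (a%:R == 0 :> 'F_p)%R by rewrite -[0%R]/(0%:R)%R eqF mod0n.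
exists g; split=> [|a|i j].
- by rewrite dvdF gE -unitfE (valP u).
- rewrite dvdF -unitfE => ua.
  have : FinRing.unit 'F_p ua \in [set: {unit 'F_p}] by rewrite inE.
  rewrite Gu => /cycleP[k e]; exists k; apply/eqP; rewrite -eqF gX.
  by rewrite -e.
move/eqP; rewrite -eqF !gX => /eqP/val_inj/eqP.
by rewrite eq_expg_mod_order ord_u => /eqP.
Qed.

Lemma legendre_eqmod a b p : a = b %[mod p] -> legendre a p = legendre b p.
Proof.
move=> e; rewrite /legendre e.
by have -> : (p %| a) = (p %| b) by rewrite /dvdn e.
Qed.

(** The exponent is determined modulo p - 1, which is even, so its parity is well defined; the
    nonzero squares are the powers with even exponent. *)
Lemma legendre_generator p g k : prime p -> odd p -> ~~ (p %| g) ->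
  (forall a, ~~ (p %| a) -> exists k, g ^ k = a %[mod p]) ->
  (forall i j, g ^ i = g ^ j %[mod p] -> i = j %[mod p.-1]) ->
  legendre (g ^ k) p = if odd k then (-1)%coqZ else 1%coqZ.
Proof.
move=> p_pr p_odd pg gen inj; rewrite /legendre Euclid_dvdX // (negPf pg) /=.
have p_gt0 := prime_gt0 p_pr.
case: ifP => [/existsP[x /eqP e]|/negbT ne].
  have px : ~~ (p %| x).
    apply: contra pg => px; have : p %| g ^ k.
      by rewrite /dvdn -e -modnMm (eqP px) mul0n mod0n.
    by rewrite Euclid_dvdX // => /andP[].
  have [j ej] := gen _ px.
  have /inj e2 : g ^ (j + j) = g ^ k %[mod p] by rewrite expnD -modnMm !ej modnMm.
  have : odd (j + j) = odd k.
    have p1 : ~~ odd p.-1 by case: (p) p_odd p_gt0 => //= q /negPf ->.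
    have oddm i : odd i = odd (i %% p.-1).
      by rewrite {1}(divn_eq i p.-1) oddD oddM (negPf p1) andbF.
    by rewrite oddm e2 -oddm.
  by rewrite addnn odd_double => <-.
case: ifP => // /negbT ev; case/existsP: ne.
exists (Ordinal (ltn_pmod (g ^ k./2) p_gt0)) => /=.
by rewrite modnMm -expnD addnn halfK (negPf ev) subn0.
Qed.

Lemma legendreM a b p : prime p -> odd p ->
  legendre (a * b) p = (legendre a p * legendre b p)%coqZ.
Proof.
move=> p_pr p_odd.
have [pa|pa] := boolP (p %| a); first by rewrite /legendre pa dvdn_mulr.
have [pb|pb] := boolP (p %| b); first by rewrite /legendre pb dvdn_mull // Z.mul_0_r.
have [g [pg gen inj]] := primitive_root_modn p_pr.
have [i ei] := gen _ pa; have [j ej] := gen _ pb.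
have eij : a * b = g ^ (i + j) %[mod p] by rewrite expnD -modnMm -ei -ej modnMm.
rewrite (legendre_eqmod eij) -(legendre_eqmod ei) -(legendre_eqmod ej).
by rewrite !(@legendre_generator p g) // oddD; case: (odd i); case: (odd j).
Qed.

Lemma legendre_nonresidue p : prime p -> odd p -> exists g, legendre g p = (-1)%coqZ.
Proof.
move=> p_pr p_odd; have [g [pg gen inj]] := primitive_root_modn p_pr.
by exists g; rewrite -[g]expn1 (@legendre_generator p g).
Qed.

Lemma legendre1 p : prime p -> odd p -> legendre 1 p = 1%coqZ.
Proof.
move=> p_pr p_odd; have [g [pg gen inj]] := primitive_root_modn p_pr.
by rewrite -[1](expn0 g) (@legendre_generator p g).
Qed.

Lemma legendre_sqr a p : (legendre a p * legendre a p)%coqZ = if p %| a then 0%coqZ else 1%coqZ.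
Proof. by rewrite /legendre; case: ifP => // _; case: ifP. Qed.

Section SquarefreeModulus.
Variable n : nat.
Hypotheses (n_odd : odd n) (n_sqf : squarefree n).

Let n_gt0 : 0 < n. Proof. exact: odd_gt0. Qed.

Lemma prime_factor_odd p : p \in primes n -> prime p /\ odd p.
Proof.
by rewrite mem_primes => /and3P[p_pr _ pn]; split=> //; apply: dvdn_odd pn n_odd.
Qed.

Lemma jacobi_primes a :
  jacobi a n = foldr (fun p acc => (legendre a p * acc)%coqZ) 1%coqZ (primes n).
Proof.
rewrite /jacobi prime_decompE.
(* The induction runs over a list of prime factors of n; this trivial inclusion carries that fact
   through it. *)
have : {subset primes n <= primes n} by [].
elim: {1 3 4}(primes n) => //= p s IH sub.
rewrite IH => [|q qs]; last by apply: sub; rewrite inE qs orbT.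
have /sub : p \in p :: s by rewrite mem_head.
rewrite mem_primes => /and3P[p_pr _ pn].
have -> : logn p n = 1.
  apply/eqP; rewrite eqn_leq -!pfactor_dvdn // expn1 pn andbT leqNgt.
  by rewrite -pfactor_dvdn // expnS expn1; apply: n_sqf.
by rewrite Z.pow_1_r.
Qed.

Lemma jacobi_mod a : jacobi (a %% n) n = jacobi a n.
Proof.
rewrite !jacobi_primes.
have : {subset primes n <= primes n} by [].
elim: {1 3 4}(primes n) => //= p s IH sub.
rewrite IH => [|q qs]; last by apply: sub; rewrite inE qs orbT.
have /sub : p \in p :: s by rewrite mem_head.
rewrite mem_primes => /and3P[p_pr _ pn].
by rewrite (@legendre_eqmod (a %% n) a) // modn_dvdm.
Qed.

Lemma jacobiM a b : jacobi (a * b) n = (jacobi a n * jacobi b n)%coqZ.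
Proof.
rewrite !jacobi_primes.
have : {subset primes n <= primes n} by [].
elim: {1 3 4 5}(primes n) => //= p s IH sub.
rewrite IH => [|q qs]; last by apply: sub; rewrite inE qs orbT.
have /sub/prime_factor_odd[p_pr p_odd] : p \in p :: s by rewrite mem_head.
by rewrite legendreM //; lia.
Qed.

Lemma coprime_all_primes a : coprime a n = all (fun p => ~~ (p %| a)) (primes n).
Proof.
apply/idP/allP => [cop p|all_n].
  rewrite mem_primes => /and3P[p_pr _ pn]; apply/negP => pa.
  have : p %| gcdn a n by rewrite dvdn_gcd pa.
  by rewrite (eqP cop) dvdn1 => /eqP p1; rewrite p1 in p_pr.
rewrite /coprime; apply: contraT => ne.
have g_gt1 : 1 < gcdn a n by rewrite ltn_neqAle eq_sym ne gcdn_gt0 n_gt0 orbT.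
have /all_n/negP[] : pdiv (gcdn a n) \in primes n.
  by rewrite mem_primes pdiv_prime // n_gt0 (dvdn_trans (pdiv_dvd _)) ?dvdn_gcdr.
by rewrite (dvdn_trans (pdiv_dvd _)) ?dvdn_gcdl.
Qed.

Lemma jacobi_sqr a : (jacobi a n * jacobi a n)%coqZ = if coprime a n then 1%coqZ else 0%coqZ.
Proof.
rewrite coprime_all_primes jacobi_primes; elim: (primes n) => //= p s IH.
set x := foldr _ _ _ in IH *.
have -> : (legendre a p * x * (legendre a p * x) =
  (legendre a p * legendre a p) * (x * x))%coqZ by lia.
by rewrite IH legendre_sqr; case: ifP => //= _; case: all.
Qed.

(** The symbol is not induced from modulus n / p: by the Chinese remainder theorem u can be 1 modulo
    n / p and a nonresidue modulo p, so that only the factor at p differs from 1. *)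
Lemma jacobi_primitive p : prime p -> p %| n ->
  exists2 u, u = 1 %[mod n %/ p] & jacobi u n = (-1)%coqZ.
Proof.
move=> p_pr pn.
have p_odd := dvdn_odd pn n_odd.
have cop : coprime (n %/ p) p.
  rewrite coprime_sym prime_coprime //; apply/negP => pnp.
  have /negP[] := n_sqf p_pr.
  by rewrite -(divnK pn) dvdn_pmul2r // prime_gt0.
have [g gN] := legendre_nonresidue p_pr p_odd.
pose u := chinese (n %/ p) p 1 g; exists u; first exact: chinese_modl.
have up : legendre u p = (-1)%coqZ by rewrite -gN; apply: legendre_eqmod; apply: chinese_modr.
have uq q : q \in primes n -> q != p -> legendre u q = 1%coqZ.
  move=> qn ne; have [q_pr q_odd] := prime_factor_odd qn.
  rewrite -(legendre1 q_pr q_odd); apply: legendre_eqmod.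
  have qnp : q %| n %/ p.
    move: qn; rewrite mem_primes => /and3P[_ _]; rewrite -{1}(divnK pn) Euclid_dvdM //.
    by case/orP=> // ; rewrite dvdn_prime2 // (negPf ne).
  by rewrite -(modn_dvdm u qnp) /u chinese_modl // modn_dvdm.
have : p \in primes n by rewrite mem_primes p_pr n_gt0.
have : uniq (primes n) := primes_uniq n.
rewrite jacobi_primes.
have : {subset primes n <= primes n} by [].
elim: {1 3 4 5}(primes n) => //= q s IH sub /andP[qs us]; rewrite inE.
have sub' : {subset s <= primes n} by move=> x xs; apply: sub; rewrite inE xs orbT.
case: eqP => [e _|/eqP ne ps].
  rewrite -e up; rewrite -e in qs.
  suff -> : foldr (fun p0 acc => (legendre u p0 * acc)%coqZ) 1%coqZ s = 1%coqZ by [].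
  elim: s sub' qs {IH sub us} => //= x s IH sub'; rewrite inE negb_or => /andP[ne ns].
  rewrite IH // => [|y ys]; last by apply: sub'; rewrite inE ys orbT.
  by rewrite uq ?sub' ?mem_head // eq_sym.
by rewrite IH // uq ?sub ?mem_head // eq_sym.
Qed.

End SquarefreeModulus.

(** * Residues not prime to the modulus *)

Lemma sum_dvdn_ord (p q : nat) : 0 < p -> \sum_(a < q * p) (p %| a) = q.
Proof.
move=> p_gt0; elim: q => [|q IH]; first by rewrite mul0n big_ord0.
rewrite mulSn big_split_ord /=.
under [X in _ + X]eq_bigr => i _ do rewrite dvdn_addr //.
rewrite IH (bigD1 (Ordinal p_gt0)) //= dvdn0 big1 ?addn0 ?add1n // => i ne.
case: (boolP (p %| i)) => // pi.
have i_gt0 : 0 < i by rewrite lt0n.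
by have := dvdn_leq i_gt0 pi; rewrite leqNgt ltn_ord.
Qed.

(** This is n - phi(n), the number of zeros of the symbol in a period and hence of random signs. *)
Definition noncoprimes (n : nat) : nat := \sum_(a < n) ~~ coprime a n.

(** Each such residue is a multiple of a prime p dividing n, and p has n / p <= n / [pdiv n]
    multiples in [0, n). *)
Lemma noncoprimes_le n : 0 < n -> noncoprimes n * pdiv n <= size (primes n) * n.
Proof.
move=> n_gt0.
have le1 : noncoprimes n <= \sum_(p <- primes n) \sum_(a < n) (p %| a).
  rewrite exchange_big; apply: leq_sum => a _.
  case cop: (coprime a n) => //=.
  have g_gt1 : 1 < gcdn a n by rewrite ltn_neqAle eq_sym gcdn_gt0 n_gt0 orbT andbT; apply/negbT.
  have pin : pdiv (gcdn a n) \in primes n.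
    by rewrite mem_primes pdiv_prime // n_gt0 (dvdn_trans (pdiv_dvd _)) ?dvdn_gcdr.
  by rewrite (big_rem _ pin) /= (dvdn_trans (pdiv_dvd _)) ?dvdn_gcdl.
apply: (@leq_trans (\sum_(p <- primes n) (\sum_(a < n) (p %| a)) * pdiv n)).
  by rewrite -big_distrl leq_mul2r le1 orbT.
rewrite -sum1_size big_distrl /= big_seq [X in _ <= X]big_seq.
apply: leq_sum => p; rewrite mem_primes => /and3P[p_pr _ pn].
have := sum_dvdn_ord (n %/ p) (prime_gt0 p_pr).
rewrite divnK // => ->; rewrite mul1n -[X in _ <= X](divnK pn).
by rewrite leq_mul2l pdiv_min_dvd ?orbT // prime_gt1.
Qed.

Lemma expn2_size_primes n : 0 < n -> 2 ^ size (primes n) <= n.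
Proof.
move=> n_gt0; rewrite [X in _ <= X](prod_prime_decomp n_gt0) prime_decompE big_map /=.
rewrite -sum1_size expn_sum big_seq [X in _ <= X]big_seq.
apply: leq_prod => p; rewrite mem_primes => /and3P[p_pr _ pn].
rewrite expn1; apply: leq_trans (prime_gt1 p_pr) _.
rewrite -[X in X <= _]expn1 leq_pexp2l ?(prime_gt0 p_pr) //.
by rewrite logn_gt0 mem_primes p_pr n_gt0.
Qed.

Local Open Scope ring_scope.

(** * Additive energy and the discrete Fourier transform *)

(** These are the coefficients of A(z)^2; for real A the sum of their squares is ||A||_4^4 by
    Parseval, and [energy_pairs] recovers the additive form. *)
Definition conv (R : pzRingType) (n : nat) (v : nat -> R) (s : nat) : R :=
  \sum_(i : 'I_n * 'I_n | (i.1 + i.2 == s)%N) v i.1 * v i.2.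

Definition energy (R : pzRingType) (n : nat) (v : nat -> R) : R :=
  \sum_(s < n.*2) conv n v s ^+ 2.

(** The map l -> k + u l permutes the residues. It serves as a shift (u = 1), as a dilation and,
    with u = n - 1 standing for -1, as a reflection. *)
Lemma sum_affine_mod (V : nmodType) (n k u : nat) (g : nat -> V) :
  (0 < n)%N -> coprime u n -> (forall a, g (a %% n)%N = g a) ->
  \sum_(l < n) g (k + u * l)%N = \sum_(l < n) g l.
Proof.
move=> n_gt0 cop_u g_mod.
pose h (l : 'I_n) : 'I_n := Ordinal (ltn_pmod (k + u * l) n_gt0).
have h_inj : injective h.
  move=> l1 l2 /(congr1 val) /= /eqP; rewrite eqn_modDl => e.
  apply/val_inj/eqP.
  rewrite /= -(modn_small (ltn_ord l1)) -(modn_small (ltn_ord l2)).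
  wlog le12 : l1 l2 e / (l2 <= l1)%N => [W|].
    case/orP: (leq_total l2 l1) => le; first exact: W.
    by rewrite eq_sym; apply: W => //; rewrite eq_sym.
  move: e; rewrite eqn_mod_dvd ?leq_mul2l ?le12 ?orbT //.
  by rewrite -mulnBr Gauss_dvdr 1?coprime_sym // eqn_mod_dvd.
rewrite [RHS](reindex_inj h_inj) /=.
by apply: eq_bigr => l _; rewrite g_mod.
Qed.

Lemma sum_conv_mul (R : comPzRingType) (n : nat) (v g : nat -> R) :
  \sum_(s < n.*2) conv n v s * g s = \sum_(i : 'I_n * 'I_n) v i.1 * v i.2 * g (i.1 + i.2)%N.
Proof.
under eq_bigr => s _ do rewrite /conv mulr_suml big_mkcond.
rewrite exchange_big /=; apply: eq_bigr => i _.
have lt_i : (i.1 + i.2 < n.*2)%N by move: (ltn_ord i.1) (ltn_ord i.2); lia.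
rewrite (bigD1 (Ordinal lt_i)) //= eqxx big1 ?addr0 // => s ne.
by case: eqP => // e; case/eqP: ne; apply: val_inj.
Qed.

Lemma energy_pairs (R : comPzRingType) (n : nat) (v : nat -> R) :
  energy n v = \sum_(i : 'I_n * 'I_n) \sum_(j : 'I_n * 'I_n | (i.1 + i.2 == j.1 + j.2)%N)
    v i.1 * v i.2 * (v j.1 * v j.2).
Proof.
rewrite /energy; under eq_bigr do rewrite expr2.
rewrite sum_conv_mul; apply: eq_bigr => i _; rewrite /conv mulr_sumr.
by apply: eq_bigl => j; rewrite eq_sym.
Qed.

Section Fourier.
Variables (C : numClosedFieldType) (n : nat) (z : C).
Hypothesis z_prim : n.-primitive_root z.

Let n_gt0 : (0 < n)%N. Proof. exact: prim_order_gt0 z_prim. Qed.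
Let nC_neq0 : n%:R != 0 :> C. Proof. by rewrite pnatr_eq0 -lt0n. Qed.

Lemma prim_root_norm : `|z| = 1.
Proof.
have /eqP := congr1 Num.norm (prim_expr_order z_prim).
by rewrite normrX normr1 pexprn_eq1 // (gtn_eqF n_gt0) => /eqP.
Qed.

Lemma prim_rootX_norm a : `|z ^+ a| = 1.
Proof. by rewrite normrX prim_root_norm expr1n. Qed.

Lemma prim_rootX_conjK a : z ^+ a * (z ^+ a)^* = 1.
Proof. by rewrite -normCK prim_rootX_norm expr1n. Qed.

Lemma prim_rootX_conj a : (z ^+ a)^* = z ^+ (n.-1 * a).
Proof.
apply: (@mulfI _ (z ^+ a)); first by rewrite -normr_gt0 prim_rootX_norm ltr01.
rewrite prim_rootX_conjK -exprD -mulSn prednK //.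
by rewrite exprM (prim_expr_order z_prim) expr1n.
Qed.

Lemma prim_root_orthogonality a b :
  \sum_(k < n) z ^+ (a * k) * (z ^+ (b * k))^* =
  if a == b %[mod n] then n%:R else 0.
Proof.
pose w := z ^+ a * (z ^+ b)^*.
have -> : \sum_(k < n) z ^+ (a * k) * (z ^+ (b * k))^* = \sum_(k < n) w ^+ k.
  by apply: eq_bigr => k _; rewrite !exprM rmorphXn exprMn.
rewrite -(eq_prim_root_expr z_prim).
case: eqP => [e|ne].
  rewrite (eq_bigr (fun=> 1)) ?sumr_const ?card_ord // => k _.
  by rewrite /w e prim_rootX_conjK expr1n.
have w_neq1 : w - 1 != 0.
  apply/eqP => /eqP; rewrite subr_eq0 => /eqP w1; apply: ne.
  by rewrite -[LHS]mulr1 -(prim_rootX_conjK b) mulrCA mulrC -/w w1 mul1r.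
apply/eqP; rewrite -(mulrI_eq0 _ (mulfI w_neq1)) -subrX1 subr_eq0.
by rewrite exprMn -rmorphXn -!exprM ![(_ * n)%N]mulnC !exprM (prim_expr_order z_prim)
           !expr1n rmorph1 mulr1.
Qed.

Definition dft (f : nat -> C) (k : nat) : C := \sum_(a < n) f a * z ^+ (a * k).

(** Frequencies are arbitrary and may repeat: pairs with frequency i + j give products of
    transforms, shifted or negated frequencies give twisted sums. *)
Lemma parseval_indexed (I J : finType) (al : I -> nat) (be : J -> nat) (f : I -> C) (g : J -> C) :
  \sum_(k < n) (\sum_i f i * z ^+ (al i * k)) * (\sum_j g j * z ^+ (be j * k))^* =
  n%:R * \sum_i \sum_(j | al i == be j %[mod n]) f i * (g j)^*.
Proof.
under eq_bigr => k _ do rewrite rmorph_sum big_distrlr /=.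
rewrite exchange_big mulr_sumr; apply: eq_bigr => i _.
rewrite exchange_big mulr_sumr [RHS]big_mkcond; apply: eq_bigr => j _ /=.
under eq_bigr => k _ do rewrite rmorphM mulrACA.
rewrite -mulr_sumr prim_root_orthogonality.
by case: ifP => _; rewrite ?mulr0 // mulrC.
Qed.

Lemma parseval f g :
  \sum_(k < n) dft f k * (dft g k)^* = n%:R * \sum_(a < n) f a * (g a)^*.
Proof.
rewrite /dft (parseval_indexed (fun i : 'I_n => i : nat) (fun i : 'I_n => i : nat)).
congr (_ * _); apply: eq_bigr => a _.
rewrite (big_pred1 a) // => b; rewrite /= !modn_small // eq_sym; exact: val_eqE.
Qed.

Lemma dft_inversion f a : (a < n)%N ->
  n%:R * f a = \sum_(k < n) dft f k * (z ^+ (a * k))^*.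
Proof.
move=> lt_a; pose i := Ordinal lt_a.
have e k : z ^+ (a * k) = dft (fun b => (b == a)%:R) k.
  rewrite /dft (bigD1 i) //= eqxx mul1r big1 ?addr0 // => b ne.
  by have /negPf -> : (b != a :> nat) := ne; rewrite mul0r.
under eq_bigr => k _ do rewrite e.
rewrite parseval (bigD1 i) //= eqxx rmorph1 mulr1 big1 ?addr0 // => b ne.
by have /negPf -> : (b != a :> nat) := ne; rewrite rmorph0 mulr0.
Qed.

(** The energy with its condition read modulo n and with four independent sequences: the quantity
    that products of transforms compute. *)
Definition quad (f g h k : nat -> C) : C :=
  \sum_(i : 'I_n * 'I_n) \sum_(j : 'I_n * 'I_n | (i.1 + i.2 == j.1 + j.2 %[mod n])%N)
    f i.1 * g i.2 * (h j.1 * k j.2)^*.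

Lemma dft_mul f g k :
  dft f k * dft g k = \sum_(i : 'I_n * 'I_n) f i.1 * g i.2 * z ^+ ((i.1 + i.2) * k).
Proof.
rewrite /dft big_distrlr /= pair_big /=; apply: eq_bigr => i _.
by rewrite mulnDl exprD mulrACA.
Qed.

Lemma quad_dft f g h k :
  n%:R * quad f g h k =
  \sum_(x < n) dft f x * dft g x * (dft h x * dft k x)^*.
Proof.
under eq_bigr => x _ do rewrite !dft_mul.
by rewrite (parseval_indexed (fun i : 'I_n * 'I_n => i.1 + i.2)%N
              (fun i : 'I_n * 'I_n => i.1 + i.2)%N).
Qed.

(* For residues in [0, n), a + b - c - d is one of -n, 0, n as soon as it is 0 mod n. *)
Lemma indicator_sum_eq (a b c d : nat) :
  (a < n)%N -> (b < n)%N -> (c < n)%N -> (d < n)%N -> (a + b == c + d %[mod n])%N ->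
  ((a + b == c + d)%N%:R : C) = 1 - (a%:R + b%:R - c%:R - d%:R) ^+ 2 / n%:R ^+ 2.
Proof.
move=> la lb lc ld.
wlog le : a b c d la lb lc ld / (c + d <= a + b)%N => [W|].
  case/orP: (leq_total (c + d) (a + b)) => le e; first exact: W.
  rewrite eq_sym W // 1?eq_sym //; congr (1 - _ / _); ring.
rewrite eqn_mod_dvd // => /dvdnP[q e].
have q_lt : (q < 2)%N by rewrite -(ltn_pmul2r n_gt0) -e; lia.
have e' : a%:R + b%:R - c%:R - d%:R = (q * n)%:R :> C.
  by rewrite -e natrB // !natrD; ring.
rewrite e' natrM.
case: q q_lt e {e'} => [|[|//]] _ e.
  have -> : (a + b == c + d)%N by lia.
  by rewrite mul0r expr0n /= mul0r subr0.
have -> : (a + b == c + d)%N = false by lia.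
by rewrite mul1r divff ?subrr // expf_neq0.
Qed.

Variable (v : nat -> C).
Hypothesis v_real : forall a, (v a)^* = v a.

(** Centering leaves i + j - k - l unchanged, makes the sum over a period vanish and keeps the
    values within n / 2. *)
Definition centered (a : nat) : C := a%:R - n.-1%:R / 2.
Local Notation t := centered.
Definition moment1 (a : nat) : C := t a * v a.
Definition moment2 (a : nat) : C := t a ^+ 2 * v a.
Local Notation v1 := moment1.
Local Notation v2 := moment2.
Local Notation F := (dft v).
Local Notation D := (dft v1).
Local Notation E := (dft v2).

Lemma centered_real a : (t a)^* = t a.
Proof. by rewrite /t rmorphB rmorphM fmorphV !rmorph_nat. Qed.

Lemma moment1_real a : (v1 a)^* = v1 a.
Proof. by rewrite /v1 rmorphM /= centered_real v_real. Qed.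

(** [indicator_sum_eq] times n^2, with the square expanded: four squares and six cross products,
    each attached to the slots of its indices. *)
Lemma energy_quad :
  n%:R ^+ 2 * energy n v = n%:R ^+ 2 * quad v v v v -
   (quad v2 v v v + quad v v2 v v + quad v v v2 v + quad v v v v2
    + 2 * quad v1 v1 v v + 2 * quad v v v1 v1
    - 2 * quad v1 v v1 v - 2 * quad v1 v v v1 - 2 * quad v v1 v1 v - 2 * quad v v1 v v1).
Proof.
rewrite /quad energy_pairs !mulr_sumr -!sumrN -?big_split -?sumrN -?big_split /=.
apply: eq_bigr => i _.
rewrite !mulr_sumr -!sumrN -?big_split -?sumrN -?big_split /=.
rewrite big_mkcond [RHS]big_mkcond /=; apply: eq_bigr => j _.
have [e|ne] := eqVneq ((i.1 + i.2) %% n)%N ((j.1 + j.2) %% n)%N; last first.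
  by case e: (i.1 + i.2 == j.1 + j.2)%N => //; rewrite (eqP e) eqxx in ne.
have := indicator_sum_eq (ltn_ord i.1) (ltn_ord i.2) (ltn_ord j.1) (ltn_ord j.2).
rewrite e eqxx => /(_ isT) ind.
rewrite !rmorphM /= !centered_real !v_real.
transitivity (n%:R ^+ 2 * ((i.1 + i.2 == j.1 + j.2)%N%:R * (v i.1 * v i.2 * (v j.1 * v j.2)))).
  by case: (_ == _); rewrite ?mul1r // mul0r mulr0.
by rewrite ind /v1 /v2 /t; field.
Qed.

End Fourier.

(** * The energy of a real primitive character *)

Lemma weighted_geometric_sum (R : comPzRingType) (w : R) (m : nat) :
  (w - 1) * \sum_(a < m) a%:R * w ^+ a = m%:R * w ^+ m - w * \sum_(a < m) w ^+ a.
Proof.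
elim: m => [|m IH]; first by rewrite !big_ord0; ring.
by rewrite !big_ord_recr /= mulrDr IH -addn1 natrD exprD expr1; ring.
Qed.

Lemma sum_ord_natr (R : comPzRingType) (m : nat) :
  2 * \sum_(a < m) a%:R = m%:R * (m%:R - 1) :> R.
Proof.
elim: m => [|m IH]; first by rewrite !big_ord0; ring.
by rewrite !big_ord_recr /= mulrDr IH -addn1 natrD; ring.
Qed.

Section RealCharacter.
Variables (C : numClosedFieldType) (n : nat) (z : C) (chi : nat -> C).
Hypothesis z_prim : n.-primitive_root z.
Hypothesis n_gt1 : (1 < n)%N.
Hypothesis chi_mod : forall a, chi (a %% n)%N = chi a.
Hypothesis chiM : forall a b, chi (a * b)%N = chi a * chi b.
Hypothesis chi_sqr : forall a, chi a ^+ 2 = (coprime a n)%:R.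
Hypothesis chi_real : forall a, (chi a)^* = chi a.
(** Primitivity in the form used by [dft_character]: chi is nontrivial on the residues congruent to
    1 modulo n / p. *)
Hypothesis chi_primitive : forall p, prime p -> (p %| n)%N ->
  exists2 u, u = 1 %[mod n %/ p] & chi u = -1.

Let n_gt0 : (0 < n)%N. Proof. exact: ltnW. Qed.
Let nC_gt0 : 0 < n%:R :> C. Proof. by rewrite ltr0n. Qed.
Let nC_neq0 : n%:R != 0 :> C. Proof. exact: lt0r_neq0. Qed.
Let two_neq0 : 2 != 0 :> C. Proof. by rewrite pnatr_eq0. Qed.

Lemma coprime_predn : coprime n.-1 n.
Proof. by rewrite -[X in coprime _ X](prednK n_gt0) coprimenS. Qed.

Lemma chi_eqmod a b : a = b %[mod n] -> chi a = chi b.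
Proof. by move=> e; rewrite -chi_mod e chi_mod. Qed.

Lemma chi_neq0_coprime a : chi a != 0 -> coprime a n.
Proof. by rewrite -sqrf_eq0 chi_sqr; case: coprime; rewrite ?eqxx. Qed.

Lemma prim_rootX_eqmod a b : a = b %[mod n] -> z ^+ a = z ^+ b.
Proof. by move=> e; apply/eqP; rewrite (eq_prim_root_expr z_prim) e. Qed.

Definition gauss : C := dft n z chi 1.

(** Gauss sums separate. If k is prime to n, substitute k a for a. Otherwise let p divide both and
    take u from [chi_primitive]: u k = k mod n, so substituting u a for a shows that the transform
    is its own negative. *)
Lemma dft_character k : dft n z chi k = chi k * gauss.
Proof.
have [cop|ncop] := boolP (coprime k n).
  suff e : chi k * dft n z chi k = gauss.
    by rewrite -e mulrA -expr2 chi_sqr cop mul1r.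
  rewrite /gauss /dft mulr_sumr.
  pose g a := chi a * z ^+ (a * 1).
  rewrite -[RHS](@sum_affine_mod _ n 0 k g) // => [|a]; last first.
    by rewrite /g chi_mod !muln1 (prim_expr_mod z_prim).
  by apply: eq_bigr => a _; rewrite /g add0n chiM muln1 mulrA [(k * a)%N]mulnC.
have chik0 : chi k = 0 by apply/eqP; rewrite -sqrf_eq0 chi_sqr (negPf ncop).
rewrite chik0 mul0r.
have g_gt1 : (1 < gcdn k n)%N.
  by rewrite ltn_neqAle eq_sym ncop gcdn_gt0 n_gt0 orbT.
set p := pdiv (gcdn k n).
have p_pr : prime p by apply: pdiv_prime.
have pk : (p %| k)%N := dvdn_trans (pdiv_dvd _) (dvdn_gcdl _ _).
have pn : (p %| n)%N := dvdn_trans (pdiv_dvd _) (dvdn_gcdr _ _).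
have [u u1 chiu] := chi_primitive p_pr pn.
have cop_u : coprime u n by apply: chi_neq0_coprime; rewrite chiu oppr_eq0 oner_eq0.
have uk : (u * k = k %[mod n])%N.
  have [q ->] := dvdnP pk.
  rewrite -[n in RHS](divnK pn) -[n in LHS](divnK pn) mulnA -!muln_modl.
  by congr (_ * _)%N; rewrite -modnMml u1 modnMml mul1n.
have : chi u * dft n z chi k = dft n z chi k.
  rewrite /dft mulr_sumr.
  pose g a := chi a * z ^+ (a * k).
  rewrite -[RHS](@sum_affine_mod _ n 0 u g) // => [|a]; last first.
    rewrite /g chi_mod; congr (_ * _); apply: prim_rootX_eqmod.
    by rewrite modnMml.
  apply: eq_bigr => a _; rewrite /g add0n chiM mulrA; congr (_ * _).
  by apply: prim_rootX_eqmod; rewrite [(u * a * k)%N]mulnAC -[RHS]modnMml uk modnMml mulnC.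
rewrite chiu mulN1r => /eqP; rewrite eq_sym -addr_eq0 -mulr2n -mulr_natr mulf_eq0.
by rewrite (negPf two_neq0) orbF => /eqP.
Qed.

(** Parseval for chi equates |gauss|^2 and n after division by the sum of chi^2, nonzero because of
    the term at 1. *)
Lemma gauss_norm : gauss * gauss^* = n%:R.
Proof.
have := parseval z_prim chi chi.
under eq_bigr => k _.
  rewrite dft_character rmorphM /= chi_real mulrACA -expr2 chi_sqr; over.
under [in RHS]eq_bigr => k _ do rewrite chi_real -expr2 chi_sqr.
rewrite -mulr_suml mulrC; apply: mulIf.
rewrite (bigD1 (Ordinal n_gt1)) //= coprime1n.
by rewrite lt0r_neq0 // ltr_pwDl ?ltr01 // sumr_ge0 // => i _; rewrite ler0n.
Qed.

Lemma gauss_conj : gauss^* = chi n.-1 * gauss.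
Proof.
rewrite -dft_character /gauss /dft rmorph_sum; apply: eq_bigr => a _ /=.
by rewrite rmorphM /= chi_real (prim_rootX_conj z_prim) muln1 mulnC.
Qed.

Variable r : nat.
Let v a := chi (a + r)%N.
Local Notation t := (centered C n).
Local Notation F := (dft n z v).
Local Notation D := (dft n z (moment1 n v)).
Local Notation E := (dft n z (moment2 n v)).

Let v_real a : (v a)^* = v a. Proof. exact: chi_real. Qed.

Lemma dft_shift k : F k = (z ^+ (r * k))^* * chi k * gauss.
Proof.
suff e : z ^+ (r * k) * F k = chi k * gauss.
  by rewrite -mulrA -e mulrA [_^* * _]mulrC (prim_rootX_conjK z_prim) mul1r.
rewrite -dft_character {1}/dft mulr_sumr /dft.
pose g a := chi a * z ^+ (a * k).
rewrite -[RHS](@sum_affine_mod _ n r 1 g) ?coprime1n // => [|a]; last first.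
  rewrite /g chi_mod; congr (_ * _); apply: prim_rootX_eqmod.
  by rewrite modnMml.
by apply: eq_bigr => a _; rewrite /g /v mul1n mulnDl exprD [(r + a)%N]addnC mulrCA.
Qed.

Lemma dft_shift_norm k : F k * (F k)^* = n%:R * chi k ^+ 2.
Proof.
rewrite dft_shift !rmorphM /= conjCK chi_real.
transitivity ((z ^+ (r * k) * (z ^+ (r * k))^*) * (gauss * gauss^*) * chi k ^+ 2); first by ring.
by rewrite (prim_rootX_conjK z_prim) gauss_norm mul1r.
Qed.

Lemma chi_cube k : chi k ^+ 2 * chi k = chi k.
Proof.
have [->|/chi_neq0_coprime c] := eqVneq (chi k) 0; first by rewrite mulr0.
by rewrite chi_sqr c mul1r.
Qed.

Lemma chi_sqr_dft k : chi k ^+ 2 * F k = F k.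
Proof. by rewrite dft_shift; rewrite -[in RHS](chi_cube k); ring. Qed.

(** One of the two conjugates of [gauss] is rewritten as chi(-1) [gauss]; with the other it makes
    |gauss|^2 = n, and the phase of the Gauss sum disappears. *)
Lemma dft_shift_conj_sqr k :
  (F k)^* ^+ 2 = n%:R * chi n.-1 * z ^+ (2 * r * k) * chi k ^+ 2.
Proof.
rewrite dft_shift !rmorphM /= conjCK chi_real.
rewrite -mulnA mul2n -addnn exprD.
transitivity (chi k ^+ 2 * (z ^+ (r * k) * z ^+ (r * k)) * (gauss^* * gauss^*)); first by ring.
by rewrite {1}gauss_conj -[chi _ * gauss * _]mulrA gauss_norm; ring.
Qed.

Lemma sum_centered : \sum_(a < n) t a = 0.
Proof.
apply: (mulfI two_neq0); rewrite mulr0 /centered sumrB mulrBr sum_ord_natr.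
rewrite sumr_const card_ord -[(_ / 2) *+ n]mulr_natr.
have -> : n%:R = n.-1%:R + 1 :> C by rewrite -{1}(prednK n_gt0) -addn1 natrD.
by field.
Qed.

(* The term x = 0 is 0^-1 = 0. *)
Definition chord_sum : C := \sum_(x < n) `|1 - z ^+ x|^-1.

(** At w = 1 the sum is 0 by centering, in agreement with 0^-1 = 0; elsewhere it equals n / (w -
    1). *)
Lemma centered_kernel y : `|\sum_(a < n) t a * (z ^+ y) ^+ a| <= n%:R * `|1 - z ^+ y|^-1.
Proof.
set w := z ^+ y.
have [->|w_neq1] := eqVneq w 1.
  under eq_bigr do rewrite expr1n mulr1.
  by rewrite sum_centered normr0 mulr_ge0 ?invr_ge0.
have wn : w ^+ n = 1 by rewrite /w exprAC (prim_expr_order z_prim) expr1n.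
have w1 : w - 1 != 0 by rewrite subr_eq0.
have sw : \sum_(a < n) w ^+ a = 0.
  by apply: (mulfI w1); rewrite -subrX1 wn subrr mulr0.
have -> : \sum_(a < n) t a * w ^+ a = n%:R / (w - 1).
  rewrite /centered; under eq_bigr do rewrite mulrBl.
  rewrite sumrB -mulr_sumr sw mulr0 subr0.
  by apply: (mulfI w1); rewrite weighted_geometric_sum wn sw mulr0 subr0 mulr1 mulrCA divff ?mulr1.
by rewrite normrM normr_nat normfV distrC.
Qed.

(* By Fourier inversion, D(k) is an average of the F(l), of modulus at most sqrt n, against
   the transform of the centered identity, which decays like the inverse chord length. *)
Lemma dft_moment_bound k : `|D k| ^+ 2 <= n%:R * chord_sum ^+ 2.
Proof.
have F_le l : `|F l| <= sqrtC n%:R.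
  rewrite -(@ler_pXn2r _ 2) ?nnegrE ?sqrtC_ge0 ?ler0n // sqrtCK normCK dft_shift_norm chi_sqr.
  by rewrite ler_piMr ?ler0n // lern1 leq_b1.
pose K x := `|1 - z ^+ x|^-1.
have e : D k = n%:R^-1 * \sum_(l < n) F l * \sum_(a < n) t a * (z ^+ (k + n.-1 * l)) ^+ a.
  apply: (mulfI nC_neq0); rewrite mulrA divff // mul1r /dft mulr_sumr.
  transitivity (\sum_(a < n) \sum_(l < n) F l * (t a * (z ^+ (k + n.-1 * l)) ^+ a)).
    apply: eq_bigr => a _; rewrite /moment1.
    transitivity (t a * z ^+ (a * k) * (n%:R * v a)); first by ring.
    rewrite (dft_inversion z_prim v (ltn_ord a)) mulr_sumr; apply: eq_bigr => l _.
    rewrite (prim_rootX_conj z_prim) -exprM mulnDl exprD [(k * a)%N]mulnC.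
    by rewrite -mulnA [(l * a)%N]mulnC; ring.
  by rewrite exchange_big /=; apply: eq_bigr => l _; rewrite mulr_sumr.
have H_ge0 : 0 <= chord_sum by apply: sumr_ge0 => x _; rewrite invr_ge0.
have D_le : `|D k| <= sqrtC n%:R * chord_sum.
  rewrite e normrM normfV normr_nat ler_pdivrMl //.
  (* The substitution l -> k - l makes the bound independent of k. *)
  rewrite /chord_sum -(@sum_affine_mod _ n k n.-1 K) ?coprime_predn //; last first.
    by move=> a; rewrite /K (prim_expr_mod z_prim).
  rewrite [sqrtC _ * _]mulr_sumr mulr_sumr; apply: le_trans (ler_norm_sum _ _ _) _.
  apply: ler_sum => l _; rewrite normrM mulrCA.
  by apply: ler_pM => //; apply: centered_kernel.
apply: le_trans (lerXn2r 2 _ _ D_le) _; rewrite ?nnegrE ?mulr_ge0 ?sqrtC_ge0 ?ler0n //.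
by rewrite exprMn sqrtCK.
Qed.

(* [n.-1] stands for -1, so this is the residue of - a - 2 r modulo n. *)
Definition reflect_idx (a : nat) : nat := ((n.-1 * (a + 2 * r)) %% n)%N.
Local Notation s := reflect_idx.

Lemma reflect_idx_ltn a : (s a < n)%N.
Proof. by rewrite ltn_pmod. Qed.

Lemma addn_predn_mul a : (a + n.-1 * a = 0 %[mod n])%N.
Proof. by rewrite -mulSn prednK // modnMr mod0n. Qed.

Lemma reflect_idxP a b : (b < n)%N ->
  (a + 2 * r == n.-1 * b %[mod n])%N = (b == s a).
Proof.
move=> lt_b; rewrite -{2}(modn_small lt_b) /s.
rewrite -(eqn_modDl b) -(eqn_modDr (n.-1 * (a + 2 * r))).
have e1 : (b + (a + 2 * r) + n.-1 * (a + 2 * r) = b %[mod n])%N.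
  by rewrite -addnA -modnDmr addn_predn_mul modnDmr addn0.
have e2 : (b + n.-1 * b + n.-1 * (a + 2 * r) = n.-1 * (a + 2 * r) %[mod n])%N.
  by rewrite -modnDml addn_predn_mul modnDml add0n.
by rewrite e1 e2.
Qed.

(** The index s a + r is -(a + r) modulo n. *)
Lemma v_reflect a : v (s a) = chi n.-1 * v a.
Proof.
rewrite /v -chiM; apply: chi_eqmod; rewrite /s modnDml.
rewrite mul2n -addnn addnA [in LHS]mulnDr -addnA -modnDmr [(n.-1 * r + r)%N]addnC.
by rewrite addn_predn_mul modnDmr addn0.
Qed.

Lemma sum_reflect_idx (V : nmodType) (g : nat -> V) :
  \sum_(a < n) g (s a) = \sum_(a < n) g a.
Proof.
pose g' a := g (a %% n)%N.
transitivity (\sum_(a < n) g' (n.-1 * (2 * r) + n.-1 * a)%N).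
  by apply: eq_bigr => a _; rewrite /g' /s -mulnDr addnC.
rewrite (@sum_affine_mod _ n _ n.-1 g') ?coprime_predn // => [|a].
  by apply: eq_bigr => a _; rewrite /g' modn_small.
by rewrite /g' modn_mod.
Qed.

Definition off_support : C := \sum_(a < n) (1 - chi a ^+ 2).

Lemma off_support_term_ge0 a : 0 <= 1 - chi a ^+ 2.
Proof. by rewrite chi_sqr subr_ge0 lern1 leq_b1. Qed.

Definition moment_defect : C := \sum_(k < n) (1 - chi k ^+ 2) * `|D k| ^+ 2.

Lemma moment_defect_le : moment_defect <= off_support * (n%:R * chord_sum ^+ 2).
Proof.
rewrite /moment_defect mulr_suml; apply: ler_sum => k _.
by apply: ler_wpM2l; [apply: off_support_term_ge0 | apply: dft_moment_bound].
Qed.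

(** The twist moves the frequencies of one factor D to a + 2 r; the other, as the transform of a
    real sequence, is the conjugate of a sum with frequencies -b. They agree only for b = s a. *)
Lemma twisted_moment_sum :
  \sum_(k < n) D k ^+ 2 * z ^+ (2 * r * k) =
  n%:R * chi n.-1 * \sum_(a < n) t a * t (s a) * v a ^+ 2.
Proof.
transitivity (\sum_(k < n) (\sum_(a < n) moment1 n v a * z ^+ ((a + 2 * r) * k)) *
    (\sum_(b < n) moment1 n v b * z ^+ ((n.-1 * b) * k))^*).
  apply: eq_bigr => k _; rewrite expr2 mulrAC; congr (_ * _).
    by rewrite /dft mulr_suml; apply: eq_bigr => a _; rewrite mulnDl exprD; ring.
  rewrite /dft rmorph_sum; apply: eq_bigr => b _ /=.
  rewrite rmorphM /= (moment1_real n v_real); congr (_ * _).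
  by rewrite -mulnA -(prim_rootX_conj z_prim) conjCK.
rewrite (parseval_indexed z_prim (fun a : 'I_n => a + 2 * r)%N (fun b : 'I_n => n.-1 * b)%N).
rewrite -[RHS]mulrA [chi _ * _]mulr_sumr; congr (_ * _); apply: eq_bigr => a _.
rewrite (big_pred1 (Ordinal (reflect_idx_ltn a))) => [|b]; last exact: reflect_idxP.
by rewrite (moment1_real n v_real) /= /moment1 v_reflect; ring.
Qed.

Let M2 : C := \sum_(a < n) t a ^+ 2 * v a ^+ 2.
Let M11 : C := \sum_(a < n) t a * t (s a) * v a ^+ 2.
(* [moment_defect] and [twisted_defect] are the errors made when chi(k)^2 is replaced by 1. *)
Let twisted_defect : C := \sum_(k < n) (1 - chi k ^+ 2) * (D k ^+ 2 * z ^+ (2 * r * k)).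

Lemma quad_vvvv : quad n v v v v = n%:R * \sum_(k < n) chi k ^+ 2.
Proof.
apply: (mulfI nC_neq0); rewrite (quad_dft z_prim) mulrA mulr_sumr.
apply: eq_bigr => k _; rewrite rmorphM /= mulrACA dft_shift_norm.
by rewrite -[chi k ^+ 2 in RHS]mulr1 -{3}(expr1n _ 2) chi_sqr; case: coprime => /=; ring.
Qed.


Lemma quad_moment2 : quad n (moment2 n v) v v v = n%:R * M2.
Proof.
apply: (mulfI nC_neq0); rewrite (quad_dft z_prim).
transitivity (\sum_(k < n) n%:R * (E k * (F k)^*)).
  apply: eq_bigr => k _.
  rewrite rmorphM /= mulrA -(mulrA (E k)) dft_shift_norm.
  rewrite -[in RHS](chi_sqr_dft k) rmorphM rmorphXn /= chi_real; ring.
rewrite -mulr_sumr (parseval z_prim); congr (_ * _); congr (_ * _).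
by apply: eq_bigr => a _; rewrite v_real /moment2; ring.
Qed.

(** Together with [quad_conj], this symmetry reduces the ten corrections in [energy_quad] to three
    values. *)
Lemma quadCl (f g h k : nat -> C) : quad n f g h k = quad n g f h k.
Proof.
apply: (mulfI nC_neq0); rewrite !(quad_dft z_prim).
by apply: eq_bigr => x _; rewrite [dft n z f x * _]mulrC.
Qed.

Lemma quad_conj (f g h k : nat -> C) : quad n f g h k = (quad n h k f g)^*.
Proof.
rewrite /quad rmorph_sum /=; under [RHS]eq_bigr => i _.
  rewrite rmorph_sum /= big_mkcond; over.
rewrite exchange_big /=; apply: eq_bigr => i _; rewrite big_mkcond.
by apply: eq_bigr => j _; rewrite eq_sym; case: ifP => // _; rewrite [RHS]rmorphM /= conjCK mulrC.
Qed.

Lemma quadCr (f g h k : nat -> C) : quad n f g h k = quad n f g k h.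
Proof. by rewrite quad_conj quadCl -quad_conj. Qed.

Lemma M2_real : M2^* = M2.
Proof.
by rewrite /M2 rmorph_sum; apply: eq_bigr => a _ /=; rewrite rmorphM !rmorphXn /= v_real centered_real.
Qed.

Lemma M11_real : M11^* = M11.
Proof.
rewrite /M11 rmorph_sum; apply: eq_bigr => a _ /=.
by rewrite !rmorphM /= v_real !centered_real.
Qed.

Lemma chi_predn_sqr : chi n.-1 * chi n.-1 = 1.
Proof. by rewrite -expr2 chi_sqr coprime_predn. Qed.

Lemma quad_moment11 :
  quad n (moment1 n v) (moment1 n v) v v = n%:R * M11 - chi n.-1 * twisted_defect.
Proof.
apply: (mulfI nC_neq0); rewrite (quad_dft z_prim).
transitivity (n%:R * chi n.-1 * (\sum_(k < n) D k ^+ 2 * z ^+ (2 * r * k) - twisted_defect)).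
  rewrite /twisted_defect -sumrB mulr_sumr; apply: eq_bigr => k _.
  by rewrite rmorphM /= -!expr2 dft_shift_conj_sqr; ring.
rewrite twisted_moment_sum -/M11.
transitivity (n%:R * (n%:R * (chi n.-1 * chi n.-1) * M11 - chi n.-1 * twisted_defect)); first by ring.
by rewrite chi_predn_sqr mulr1.
Qed.

Lemma quad_moment1 : quad n (moment1 n v) v (moment1 n v) v = n%:R * M2 - moment_defect.
Proof.
apply: (mulfI nC_neq0); rewrite (quad_dft z_prim).
transitivity (n%:R * (\sum_(x < n) D x * (D x)^* - moment_defect)).
  rewrite /moment_defect -sumrB mulr_sumr; apply: eq_bigr => x _.
  by rewrite rmorphM /= mulrACA dft_shift_norm normCK; ring.
rewrite (parseval z_prim); congr (_ * (_ * _ - _)).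
by apply: eq_bigr => a _; rewrite (moment1_real n v_real) /moment1; ring.
Qed.

Lemma energy_character_exact :
  n%:R ^+ 2 * energy n v = n%:R ^+ 3 * \sum_(k < n) chi k ^+ 2 + 4 * n%:R * (M2 - M11)
    + (2 * chi n.-1 * (twisted_defect + twisted_defect^*) - 8 * moment_defect).
Proof.
rewrite (@energy_quad _ n z) // quad_vvvv.
rewrite [quad n v (moment2 n v) v v]quadCl [quad n v v v (moment2 n v)]quadCr.
rewrite [quad n v v (moment2 n v) v]quad_conj quad_moment2.
rewrite [quad n v v (moment1 n v) (moment1 n v)]quad_conj quad_moment11.
rewrite [quad n v (moment1 n v) (moment1 n v) v]quadCl.
rewrite [quad n v (moment1 n v) v (moment1 n v)]quadCl.
rewrite [quad n (moment1 n v) v v (moment1 n v)]quadCr quad_moment1.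
rewrite rmorphB !rmorphM /= rmorph_nat M2_real M11_real chi_real; ring.
Qed.

Lemma twisted_defect_le : `|twisted_defect| <= moment_defect.
Proof.
apply: le_trans (ler_norm_sum _ _ _) _; apply: ler_sum => k _.
by rewrite normrM (ger0_norm (off_support_term_ge0 k)) normrM (prim_rootX_norm z_prim) mulr1 normrX.
Qed.

Lemma centered_le a : (a < n)%N -> `|t a| <= n%:R / 2.
Proof.
move=> lt_a; rewrite /centered.
have -> : a%:R - n.-1%:R / 2 = (a%:R * 2 - n.-1%:R) / 2 :> C by field.
rewrite normrM normfV normr_nat ler_pM2r ?invr_gt0 ?ltr0n //.
have e : n%:R = n.-1%:R + 1 :> C by rewrite -{1}(prednK n_gt0) -addn1 natrD.
have le : a%:R <= n.-1%:R :> C by rewrite ler_nat -ltnS prednK.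
have age0 : 0 <= a%:R :> C by rewrite ler0n.
have rC : (a%:R * 2 - n.-1%:R : C) \is Num.real by rewrite realB ?realM ?realn.
rewrite real_ler_norml // e lerBlDr lerBrDr; apply/andP; split.
  rewrite opprD -addrA [- 1 + _]addrC addrA addNr add0r (le_trans (lerN10 _)) //.
  by rewrite mulr_ge0 ?ler0n.
have -> : a%:R * 2 = a%:R + a%:R :> C by ring.
by rewrite addrAC; apply: ler_wpDr; [apply: ler01 | apply: lerD].
Qed.

Lemma sum_off_support_shift : \sum_(a < n) (1 - v a ^+ 2) = off_support.
Proof.
pose g a := 1 - chi a ^+ 2.
rewrite /off_support -(@sum_affine_mod _ n r 1 g) ?coprime1n //; last by move=> a; rewrite /g chi_mod.
by apply: eq_bigr => a _; rewrite /g /v mul1n addnC.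
Qed.

(** Replacing v^2 by 1 changes only the terms where v vanishes, [off_support] in number and each at
    most (n / 2)^2. *)
Lemma drop_support_le (g h : nat -> C) :
  (forall a, (a < n)%N -> `|g a| <= n%:R / 2) -> (forall a, (a < n)%N -> `|h a| <= n%:R / 2) ->
  `|\sum_(a < n) g a * h a * v a ^+ 2 - \sum_(a < n) g a * h a| <= off_support * (n%:R ^+ 2 / 4).
Proof.
move=> g_le h_le; rewrite -sumrB -sum_off_support_shift mulr_suml.
apply: le_trans (ler_norm_sum _ _ _) _; apply: ler_sum => a _.
have -> : g a * h a * v a ^+ 2 - g a * h a = - ((1 - v a ^+ 2) * (g a * h a)) by ring.
rewrite normrN normrM (ger0_norm (off_support_term_ge0 _)).
apply: ler_wpM2l; first exact: off_support_term_ge0.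
have -> : n%:R ^+ 2 / 4 = (n%:R / 2) * (n%:R / 2) :> C by field.
by rewrite normrM ler_pM // ?g_le ?h_le.
Qed.

(** As s permutes the residues, the sum of (a - s a)^2 is 2 (T2 - T11), where T2 and T11 are M2 and
    M11 without the weight v^2; so 4 n (M2 - M11) yields the main term. *)
Theorem energy_character :
  `|n%:R ^+ 2 * energy n v - (n%:R ^+ 4 + 2 * n%:R * \sum_(a < n) (a%:R - (s a)%:R) ^+ 2)| <=
  off_support * (3 * n%:R ^+ 3 + 12 * n%:R * chord_sum ^+ 2).
Proof.
pose T2 := \sum_(a < n) t a * t a.
pose T11 := \sum_(a < n) t a * t (s a).
have eT : \sum_(a < n) (a%:R - (s a)%:R) ^+ 2 = 2 * (T2 - T11).
  have -> : 2 * (T2 - T11) = T2 + T2 - 2 * T11 by ring.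
  rewrite {2}/T2 -(sum_reflect_idx (fun a => t a * t a)) /T2 /T11 mulr_sumr -big_split -sumrB /=.
  by apply: eq_bigr => a _; rewrite /centered; ring.
have e1 : `|M2 - T2| <= off_support * (n%:R ^+ 2 / 4).
  by apply: drop_support_le => a; apply: centered_le.
have e2 : `|M11 - T11| <= off_support * (n%:R ^+ 2 / 4).
  apply: (@drop_support_le (fun a => t a) (fun a => t (s a))) => a lt_a; apply: centered_le => //.
  exact: reflect_idx_ltn.
have e3 := moment_defect_le.
have e4 := twisted_defect_le.
have chi1 : `|chi n.-1| = 1.
  have /eqP : `|chi n.-1| ^+ 2 = 1 by rewrite -normrX chi_sqr coprime_predn normr1.
  by rewrite pexprn_eq1 //= => /eqP.
have off_ge0 : 0 <= off_support by apply: sumr_ge0 => k _; apply: off_support_term_ge0.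
have md_ge0 : 0 <= moment_defect.
  by apply: sumr_ge0 => k _; rewrite mulr_ge0 ?off_support_term_ge0 ?exprn_ge0.
have echi : \sum_(k < n) chi k ^+ 2 = n%:R - off_support.
  by rewrite /off_support sumrB sumr_const card_ord opprB addrC subrK.
rewrite energy_character_exact eT echi.
set td := twisted_defect in e4 *; set md := moment_defect in e3 e4 md_ge0 *.
set off := off_support in e1 e2 e3 off_ge0 *.
have -> : n%:R ^+ 3 * (n%:R - off) + 4 * n%:R * (M2 - M11) +
    (2 * chi n.-1 * (td + td^*) - 8 * md) - (n%:R ^+ 4 + 2 * n%:R * (2 * (T2 - T11))) =
   - (n%:R ^+ 3 * off) + 4 * n%:R * (M2 - T2) - 4 * n%:R * (M11 - T11)
    + (2 * chi n.-1 * td + 2 * chi n.-1 * td^* - 8 * md) by ring.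
have n_ge0 := ltW nC_gt0.
have b1 : `|n%:R ^+ 3 * off| <= n%:R ^+ 3 * off by rewrite ger0_norm // mulr_ge0 ?exprn_ge0.
have b2 : `|4 * n%:R * (M2 - T2)| <= 4 * n%:R * (off * (n%:R ^+ 2 / 4)).
  by rewrite normrM ger0_norm ?ler_wpM2l ?mulr_ge0 ?ler0n.
have b3 : `|4 * n%:R * (M11 - T11)| <= 4 * n%:R * (off * (n%:R ^+ 2 / 4)).
  by rewrite normrM ger0_norm ?ler_wpM2l ?mulr_ge0 ?ler0n.
have b4 : `|2 * chi n.-1 * td| <= 2 * md.
  by rewrite !normrM chi1 normr_nat mulr1 ler_wpM2l ?ler0n.
have b5 : `|2 * chi n.-1 * td^*| <= 2 * md.
  by rewrite !normrM chi1 normr_nat mulr1 norm_conjC ler_wpM2l ?ler0n.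
have b6 : `|8 * md| <= 8 * md by rewrite ger0_norm // mulr_ge0 ?ler0n.
(* Three errors cost at most n^3 off each: the zeros missing from the sum of chi^2, and the passages
   from M2 to T2 and from M11 to T11. The defects weigh 2 + 2 + 8 = 12. *)
apply: (@le_trans _ _ (n%:R ^+ 3 * off + 4 * n%:R * (off * (n%:R ^+ 2 / 4)) +
  4 * n%:R * (off * (n%:R ^+ 2 / 4)) + (2 * md + 2 * md + 8 * md))).
  apply: le_trans (ler_normD _ _) _; apply: lerD.
    apply: le_trans (ler_normB _ _) _; apply: lerD => //.
    by apply: le_trans (ler_normD _ _) _; apply: lerD => //; rewrite normrN.
  apply: le_trans (ler_normB _ _) _; apply: lerD => //.
  by apply: le_trans (ler_normD _ _) _; apply: lerD.
have -> : n%:R ^+ 3 * off + 4 * n%:R * (off * (n%:R ^+ 2 / 4)) +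
  4 * n%:R * (off * (n%:R ^+ 2 / 4)) + (2 * md + 2 * md + 8 * md) =
  3 * n%:R ^+ 3 * off + 12 * md by field.
have -> : off * (3 * n%:R ^+ 3 + 12 * n%:R * chord_sum ^+ 2) =
  3 * n%:R ^+ 3 * off + 12 * (off * (n%:R * chord_sum ^+ 2)) by ring.
by rewrite lerD2l ler_wpM2l ?ler0n.
Qed.

End RealCharacter.

(** * Random signs *)

(** The cross term in (x + y)^2 - x^2 is at most e x^2 + e^-1 y^2 in absolute value; e is chosen
    later to balance the two sums. *)
Lemma energy_perturbation (F : realFieldType) (n : nat) (u v : nat -> F) (e : F) : 0 < e ->
  `|energy n v - energy n u| <=
  e * energy n u + (1 + e^-1) * \sum_(s < n.*2) (conv n v s - conv n u s) ^+ 2.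
Proof.
move=> e_gt0; rewrite /energy -sumrB !mulr_sumr -big_split /=.
apply: le_trans (ler_norm_sum _ _ _) _; apply: ler_sum => s _.
set x := conv n u s; set w := conv n v s.
have -> : w = x + (w - x) by ring.
set y := w - x; rewrite [x + y - x]addrC addKr.
have ei : 0 < e^-1 by rewrite invr_gt0.
have eei : e * e^-1 = 1 by rewrite divff // gt_eqF.
have h1 : 0 <= e * (x - e^-1 * y) ^+ 2 by rewrite mulr_ge0 ?sqr_ge0 // ltW.
have h2 : 0 <= e * (x + e^-1 * y) ^+ 2 by rewrite mulr_ge0 ?sqr_ge0 // ltW.
have q1 : e * (x - e^-1 * y) ^+ 2 = e * x ^+ 2 - 2 * (e * e^-1) * (x * y) + (e * e^-1) * e^-1 * y ^+ 2 by ring.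
have q2 : e * (x + e^-1 * y) ^+ 2 = e * x ^+ 2 + 2 * (e * e^-1) * (x * y) + (e * e^-1) * e^-1 * y ^+ 2 by ring.
rewrite q1 eei in h1; rewrite q2 eei in h2.
have y2 := sqr_ge0 y.
have -> : (x + y) ^+ 2 - x ^+ 2 = 2 * (x * y) + y ^+ 2 by ring.
rewrite ler_norml mulrDl mul1r; apply/andP; split; lra.
Qed.

Section RandomSigns.
Variables (F : realFieldType) (n : nat) (Om : finType) (A : {set Om}).
Variables (X : Om -> nat -> F) (B : pred nat).
(** Stands for independent symmetric signs: flips of single coordinates make every moment with an
    odd exponent vanish. *)
Hypothesis X_flip : forall i, (i < n)%N -> exists phi : Om -> Om,
  [/\ injective phi, forall w, (phi w \in A) = (w \in A),
      forall w, X (phi w) i = - X w i &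
      forall w j, (j < n)%N -> j != i -> X (phi w) j = X w j].
Hypothesis X_sqr : forall w i, w \in A -> (i < n)%N -> X w i ^+ 2 = (B i)%:R.

Definition support_size : nat := \sum_(i < n) B i.
Local Notation m := support_size.

(** Reindexing by the flip at i negates the sum. The condition on Y expresses that it depends only
    on the other coordinates. *)
Lemma sum_odd_zero i (Y : Om -> F) : (i < n)%N ->
  (forall phi : Om -> Om, (forall w j, (j < n)%N -> j != i -> X (phi w) j = X w j) ->
    forall w, Y (phi w) = Y w) ->
  \sum_(w in A) X w i * Y w = 0.
Proof.
move=> lt_i Y_inv; have [phi [phi_inj phiA Xi Xj]] := X_flip lt_i.
set S := (X in X = _).
suff : S = - S by lra.
rewrite {1}/S (reindex_inj phi_inj) -sumrN /=.
apply: eq_big => [w|w _]; first exact: phiA.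
by rewrite Xi (Y_inv _ Xj) mulNr.
Qed.

Lemma second_moment (c : nat -> F) : (forall i, c i ^+ 2 <= 1) ->
  \sum_(w in A) (\sum_(b < n) c b * X w b) ^+ 2 <= #|A|%:R * m%:R.
Proof.
move=> c_le.
under eq_bigr => w _ do rewrite expr2 big_distrlr /=.
rewrite exchange_big /= /support_size natr_sum mulr_sumr; apply: ler_sum => b _.
rewrite exchange_big (bigD1 b) //= [X in _ + X]big1 ?addr0 => [|b' ne]; last first.
  transitivity (\sum_(w in A) X w b * (c b * (c b' * X w b'))).
    by apply: eq_bigr => w _; ring.
  by apply: sum_odd_zero => // phi Xj w; rewrite Xj.
apply: (@le_trans _ _ (\sum_(w in A) (B b)%:R)); last by rewrite sumr_const mulrC mulr_natr.
apply: ler_sum => w wA.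
rewrite mulrACA -!expr2 X_sqr //.
by case: (B b); rewrite ?mulr1 ?mulr0.
Qed.

Lemma support_size_le : (m <= n)%N.
Proof.
rewrite -[n in (_ <= n)%N]card_ord -sum1_card; apply: leq_sum => i _; exact: leq_b1.
Qed.

(** Unless {a, b} = {c, d}, some index occurs exactly once and the sum vanishes: a if a <> b, and c
    if a = b, since a + b = c + d then forces c <> d. *)
Lemma fourth_moment_term (a b c d : 'I_n) : (a + b = c + d)%N ->
  \sum_(w in A) X w a * X w b * (X w c * X w d) <=
  #|A|%:R * (((a, b) == (c, d))%:R + ((a, b) == (d, c))%:R) * ((B a)%:R * (B b)%:R).
Proof.
move=> e.
have rhs_ge0 (P Q : bool) : 0 <= #|A|%:R * (P%:R + Q%:R) * ((B a)%:R * (B b)%:R) :> F.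
  by rewrite !mulr_ge0 ?addr_ge0 ?ler0n.
have paired (Y : Om -> F) : (forall w, w \in A -> Y w = X w a ^+ 2 * X w b ^+ 2) ->
    \sum_(w in A) Y w = #|A|%:R * ((B a)%:R * (B b)%:R).
  move=> Ye; rewrite mulr_natl -sumr_const; apply: eq_bigr => w wA.
  by rewrite Ye // !X_sqr.
have [eac|nac] := eqVneq a c.
  have ebd : b = d by apply: val_inj => /=; move: e; rewrite eac; lia.
  rewrite -eac -ebd eqxx (paired _) => [|w _]; last by ring.
  rewrite ler_wpM2r ?mulr_ge0 ?ler0n //.
  by rewrite ler_peMr ?ler0n // lerDl ler0n.
have [ead|nad] := eqVneq a d.
  have ebc : b = c by apply: val_inj => /=; move: e; rewrite ead; lia.
  rewrite -ead -ebc eqxx (paired _) => [|w _]; last by ring.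
  rewrite ler_wpM2r ?mulr_ge0 ?ler0n //.
  by rewrite ler_peMr ?ler0n // lerDr ler0n.
suff -> : \sum_(w in A) X w a * X w b * (X w c * X w d) = 0 by apply: rhs_ge0.
have nacn : (a != c :> nat) by [].
have nadn : (a != d :> nat) by [].
have [eab|nab] := eqVneq a b.
  have ncd : (d != c :> nat) by move: e nacn; rewrite -eab; lia.
  transitivity (\sum_(w in A) X w c * (X w a * X w b * X w d)).
    by apply: eq_bigr => w _; ring.
  by apply: sum_odd_zero => // phi Xj w; rewrite !Xj // -eab.
transitivity (\sum_(w in A) X w a * (X w b * X w c * X w d)).
  by apply: eq_bigr => w _; ring.
apply: sum_odd_zero => // phi Xj w; rewrite !Xj // eq_sym //.
Qed.

Lemma fourth_moment : \sum_(w in A) energy n (X w) <= #|A|%:R * (2 * m%:R ^+ 2).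
Proof.
under eq_bigr => w _ do rewrite energy_pairs.
rewrite exchange_big /=.
apply: (@le_trans _ _ (\sum_(i : 'I_n * 'I_n)
   #|A|%:R * (2 * ((B i.1)%:R * (B i.2)%:R)))); last first.
  rewrite -mulr_sumr -mulr_sumr expr2 /support_size natr_sum big_distrlr /=.
  by rewrite [in leRHS]pair_big.
apply: ler_sum => i _; rewrite exchange_big /=.
apply: (@le_trans _ _ (\sum_(j : 'I_n * 'I_n)
   #|A|%:R * ((i == j)%:R + (i == (j.2, j.1))%:R) * ((B i.1)%:R * (B i.2)%:R))).
  rewrite big_mkcond; apply: ler_sum => j _.
  case: ifP => [/eqP e|_]; last by rewrite !mulr_ge0 ?addr_ge0 ?ler0n.
  apply: le_trans (fourth_moment_term e) _.
  by rewrite -!surjective_pairing.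
rewrite -mulr_suml -mulr_sumr big_split /=.
have -> : \sum_(j : 'I_n * 'I_n) (i == j)%:R = 1 :> F.
  by rewrite (bigD1 i) //= eqxx big1 ?addr0 // => j /negPf ne; rewrite eq_sym ne.
have -> : \sum_(j : 'I_n * 'I_n) (i == (j.2, j.1))%:R = 1 :> F.
  rewrite (bigD1 (i.2, i.1)) //= -surjective_pairing eqxx big1 ?addr0 // => j ne.
  by case e: (i == _) => //; move: ne; rewrite (eqP e) /= -surjective_pairing eqxx.
by rewrite -mulrA.
Qed.

Lemma conv_add (u v : nat -> F) s :
  conv n (fun k => u k + v k) s - conv n u s =
  2 * (\sum_(i : 'I_n * 'I_n | (i.1 + i.2 == s)%N) u i.1 * v i.2) + conv n v s.
Proof.
have sw : \sum_(i : 'I_n * 'I_n | (i.1 + i.2 == s)%N) u i.1 * v i.2 =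
          \sum_(i : 'I_n * 'I_n | (i.1 + i.2 == s)%N) v i.1 * u i.2.
  pose h (i : 'I_n * 'I_n) := (i.2, i.1).
  have hK : involutive h by case.
  rewrite (reindex_inj (inv_inj hK)) /=; apply: eq_big => [i|i _]; first by rewrite addnC.
  exact: mulrC.
have -> (x y : F) : 2 * x + y = x + x + y by ring.
rewrite {2}sw /conv -big_split -sumrB -big_split /=.
by apply: eq_bigr => i _; ring.
Qed.

(** Exhibits the mixed convolution as a linear form in v with coefficients taken from u, the shape
    required by [second_moment]. *)
Lemma cross_conv (u v : nat -> F) s :
  \sum_(i : 'I_n * 'I_n | (i.1 + i.2 == s)%N) u i.1 * v i.2 =
  \sum_(b < n) (if (b <= s)%N && (s - b < n)%N then u (s - b)%N else 0) * v b.
Proof.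
rewrite big_mkcond /= -(pair_big predT predT (fun a b : 'I_n => if (a + b == s)%N then u a * v b else 0)) /=.
rewrite exchange_big /=; apply: eq_bigr => b _.
case: ifP => [/andP[le_b lt_b]|/negbT nb].
  rewrite (bigD1 (Ordinal lt_b)) //= subnK // eqxx big1 ?addr0 // => a ne.
  case: eqP => // e; case/eqP: ne; apply: val_inj => /=; lia.
rewrite mul0r big1 // => a _; case: eqP => // e.
by case/negP: nb; rewrite -e addnK leq_addl ltn_ord.
Qed.

(** By (2 p + q)^2 <= 8 p^2 + 2 q^2, the mixed part costs 8 m for each of the 2 n values of s and
    the quadratic part 4 m^2 <= 4 n m: on average 20 n m. *)
Lemma expected_perturbation (u : nat -> F) : (forall i, u i ^+ 2 <= 1) ->
  \sum_(w in A) \sum_(s < n.*2) (conv n (fun k => u k + X w k) s - conv n u s) ^+ 2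
  <= #|A|%:R * (20 * n%:R * m%:R).
Proof.
move=> u_le.
apply: (@le_trans _ _ (\sum_(w in A) (\sum_(s < n.*2)
   8 * (\sum_(i : 'I_n * 'I_n | (i.1 + i.2 == s)%N) u i.1 * X w i.2) ^+ 2
   + 2 * energy n (X w)))).
  apply: ler_sum => w _; rewrite /energy mulr_sumr -big_split /=; apply: ler_sum => s _.
  rewrite conv_add; set p := \sum_(_ | _) _; set q := conv _ _ _.
  have : 0 <= (2 * p - q) ^+ 2 by apply: sqr_ge0.
  by nra.
rewrite big_split exchange_big /= -[X in _ + X]mulr_sumr.
have f4 := fourth_moment.
have f2 : \sum_(s < n.*2) \sum_(w in A)
    8 * (\sum_(i : 'I_n * 'I_n | (i.1 + i.2 == s)%N) u i.1 * X w i.2) ^+ 2 <=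
    2 * n%:R * (8 * (#|A|%:R * m%:R)).
  apply: (@le_trans _ _ (\sum_(s < n.*2) (8 * (#|A|%:R * m%:R)))); last first.
    by rewrite sumr_const card_ord -[_ *+ n.*2]mulr_natl -mul2n natrM.
  apply: ler_sum => s _; rewrite -mulr_sumr ler_wpM2l ?ler0n //.
  under eq_bigr => w _ do rewrite cross_conv.
  apply: (second_moment (c := fun b => if (b <= s)%N && (s - b < n)%N then u (s - b)%N else 0)).
  by move=> i; case: ifP => // _; rewrite expr0n /= ler01.
have mn : m%:R <= n%:R :> F by rewrite ler_nat support_size_le.
have A0 : 0 <= #|A|%:R :> F by rewrite ler0n.
have m0 : 0 <= m%:R :> F by rewrite ler0n.
have Am : #|A|%:R * m%:R * m%:R <= #|A|%:R * m%:R * n%:R :> F by rewrite ler_wpM2l ?mulr_ge0.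
set T := \sum_(s < _) _ in f2 *; set U := \sum_(w in A) _ in f4 *.
apply: (@le_trans _ _ (2 * n%:R * (8 * (#|A|%:R * m%:R)) + 2 * (#|A|%:R * (2 * m%:R ^+ 2)))).
 by apply: lerD => //; apply: ler_wpM2l => //; apply: ler0n.
nra.
Qed.

End RandomSigns.

(** * Norms on the unit circle *)

Definition cos_sum (n : nat) (a : nat -> R) (t : R) : R := \sum_(j < n) a j * cos (INR j * t)%coqR.
Definition sin_sum (n : nat) (a : nat -> R) (t : R) : R := \sum_(j < n) a j * sin (INR j * t)%coqR.

Lemma circ_cos_sin n a t : circ n a t = (cos_sum n a t, sin_sum n a t).
Proof.
rewrite /circ /cos_sum /sin_sum -!(big_mkord xpredT (fun j => a j * _ (INR j * t)%coqR)).
rewrite /index_iota subn0; elim: (seq.iota 0 n) => [|j s IH] /=; first by rewrite !big_nil.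
by rewrite IH !big_cons.
Qed.

Lemma Cmod_circ_sqr n a t :
  (Cmod (circ n a t) ^ 2)%coqR = cos_sum n a t ^+ 2 + sin_sum n a t ^+ 2.
Proof.
rewrite /Cmod circ_cos_sin pow2_sqrt; first by rewrite !RealsE.
by apply/RleP; rewrite !RealsE addr_ge0 ?sqr_ge0.
Qed.

Lemma Cmod_circ_pow4 n a t :
  (Cmod (circ n a t) ^ 4)%coqR = cos_sum n.*2 (conv n a) t ^+ 2 + sin_sum n.*2 (conv n a) t ^+ 2.
Proof.
have -> : (Cmod (circ n a t) ^ 4)%coqR = (Cmod (circ n a t) ^ 2)%coqR ^+ 2.
  by rewrite !RealsE -exprM.
rewrite Cmod_circ_sqr.
have -> : cos_sum n.*2 (conv n a) t = cos_sum n a t ^+ 2 - sin_sum n a t ^+ 2.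
  rewrite /cos_sum (sum_conv_mul n a (fun s => cos (INR s * t)%coqR)) /sin_sum !expr2 !big_distrlr /=.
  rewrite !pair_big -sumrB /=; apply: eq_bigr => i _.
  by rewrite plus_INR Rmult_plus_distr_r cos_plus !RealsE; ring.
have -> : sin_sum n.*2 (conv n a) t = cos_sum n a t * sin_sum n a t + sin_sum n a t * cos_sum n a t.
  rewrite /sin_sum (sum_conv_mul n a (fun s => sin (INR s * t)%coqR)) /cos_sum !big_distrlr /=.
  rewrite !pair_big -big_split /=; apply: eq_bigr => i _.
  by rewrite plus_INR Rmult_plus_distr_r sin_plus !RealsE; ring.
ring.
Qed.

Lemma is_RInt_sum (m : nat) (F : nat -> R -> R) (l : nat -> R) (a b : R) :
  (forall i, is_RInt (F i) a b (l i)) ->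
  is_RInt (fun t => \sum_(i < m) F i t) a b (\sum_(i < m) l i).
Proof.
move=> Fl; elim: m => [|m IH].
  apply: (@is_RInt_ext R_NormedModule (fun _ : R => 0 : R)) => [t _|]; first by rewrite big_ord0.
  rewrite big_ord0; have := @is_RInt_const R_NormedModule a b (0 : R).
  by rewrite (_ : scal _ _ = 0 :> R) // /scal /= /mult /= Rmult_0_r.
apply: (@is_RInt_ext R_NormedModule (fun t => plus (\sum_(i < m) F i t) (F m t))) => [t _|].
  by rewrite big_ord_recr.
rewrite big_ord_recr; exact: is_RInt_plus.
Qed.

Lemma is_RInt_cos_diff (j k : nat) :
  is_RInt (fun t => cos (INR j * t - INR k * t)%coqR) 0 (2 * PI)%coqR
    (if j == k then 2 * PI else 0)%coqR.
Proof.
case: eqP => [->|/eqP ne].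
  apply: (@is_RInt_ext R_NormedModule (fun _ => 1%coqR)) => [t _|].
    by rewrite Rminus_diag cos_0.
  have := @is_RInt_const R_NormedModule 0%coqR (2 * PI)%coqR 1%coqR.
  by rewrite /scal /= /mult /= Rmult_1_r Rminus_0_r.
have c0 : (INR j - INR k)%coqR <> 0%coqR.
  by move=> e; case/eqP: ne; apply: INR_eq; Lra.lra.
pose G t := (sin (INR j * t - INR k * t) / (INR j - INR k))%coqR.
have e : minus (G (2 * PI)%coqR) (G 0%coqR) = 0%coqR.
  have per i : sin (INR i * (2 * PI))%coqR = 0%coqR.
    rewrite -sin_0 -(sin_period 0 i); congr sin; Lra.lra.
  rewrite /G sin_minus !per !Rmult_0_r Rmult_0_l Rminus_diag sin_0.
  by rewrite /minus /plus /Hierarchy.opp /= /Rdiv Rmult_0_l; Lra.lra.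
suff : is_RInt (fun t => cos (INR j * t - INR k * t)%coqR) 0 (2 * PI)%coqR
    (minus (G (2 * PI)%coqR) (G 0%coqR)) by rewrite e.
apply: (@is_RInt_derive R_CompleteNormedModule G) => t _.
  rewrite /G; auto_derive => //; rewrite !RealsE; field.
  by apply/eqP => e0; apply: c0; rewrite !RealsE.
by apply: ex_derive_continuous; auto_derive.
Qed.

Lemma is_RInt_trig_sqr (m : nat) (w : nat -> R) :
  is_RInt (fun t => cos_sum m w t ^+ 2 + sin_sum m w t ^+ 2) 0 (2 * PI)%coqR
    ((2 * PI)%coqR * \sum_(j < m) w j ^+ 2).
Proof.
apply: (@is_RInt_ext R_NormedModule (fun t => \sum_(j < m) \sum_(k < m)
   (scal (w j * w k : R) (cos (INR j * t - INR k * t)%coqR)))) => [t _|].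
  rewrite /cos_sum /sin_sum !expr2 !big_distrlr /= -big_split; apply: eq_bigr => j _ /=.
  rewrite -big_split; apply: eq_bigr => k _ /=.
  by rewrite cos_minus /scal /= /mult /= !RealsE; ring.
have -> : (2 * PI)%coqR * \sum_(j < m) w j ^+ 2 =
    \sum_(j < m) \sum_(k < m) scal (w j * w k : R) (if j == k :> nat then 2 * PI else 0)%coqR.
  rewrite mulr_sumr; apply: eq_bigr => j _; rewrite (bigD1 j) //= eqxx big1 ?addr0.
    by rewrite /scal /= /mult /= !RealsE; ring.
  move=> k ne; rewrite eq_sym; have /negPf -> : k != j :> nat by [].
  by rewrite /scal /= /mult /= Rmult_0_r.
pose G j k t : R := scal (w j * w k : R) (cos (INR j * t - INR k * t)%coqR).
pose l j k : R := scal (w j * w k : R) (if j == k :> nat then 2 * PI else 0)%coqR.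
apply: (@is_RInt_sum m (fun j t => \sum_(k < m) G j k t) (fun j => \sum_(k < m) l j k)) => j.
apply: (@is_RInt_sum m (G j) (l j)) => k.
by apply: is_RInt_scal; apply: is_RInt_cos_diff.
Qed.

Lemma Lpow2 n a : Lpow n a 2 = \sum_(j < n) a j ^+ 2.
Proof.
rewrite /Lpow (is_RInt_unique _ _ _ ((2 * PI)%coqR * \sum_(j < n) a j ^+ 2)).
  rewrite -Rmult_assoc Rinv_l ?Rmult_1_l //; have := PI_RGT_0; Lra.lra.
apply: (@is_RInt_ext R_NormedModule (fun t => cos_sum n a t ^+ 2 + sin_sum n a t ^+ 2)) => [t _|].
  by rewrite Cmod_circ_sqr.
exact: is_RInt_trig_sqr.
Qed.

Lemma Lpow4 n a : Lpow n a 4 = energy n a.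
Proof.
rewrite /Lpow (is_RInt_unique _ _ _ ((2 * PI)%coqR * energy n a)).
  rewrite -Rmult_assoc Rinv_l ?Rmult_1_l //; have := PI_RGT_0; Lra.lra.
apply: (@is_RInt_ext R_NormedModule
  (fun t => cos_sum n.*2 (conv n a) t ^+ 2 + sin_sum n.*2 (conv n a) t ^+ 2)) => [t _|].
  by rewrite Cmod_circ_pow4.
exact: is_RInt_trig_sqr.
Qed.

(** * The energy of the rotated Jacobi sequence *)

(** The induction step is ln (1 - 1 / (k + 2)) <= - 1 / (k + 2), an instance of 1 + x <= exp x. *)
Lemma harmonic_le_ln (k : nat) : (\sum_(x < k.+1) (x.+1%:R : R)^-1 <= 1 + ln k.+1%:R).
Proof.
elim: k => [|k IH].
  by rewrite big_ord1 -INRE /= ln_1 invr1 addr0.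
rewrite big_ord_recr /=; apply: le_trans (lerD IH (lexx _)) _.
rewrite -addrA lerD2l -!INRE.
have p1 : (0 < INR k.+1)%coqR by apply: lt_0_INR; lia.
have p2 : (0 < INR k.+2)%coqR by apply: lt_0_INR; lia.
apply/RleP; rewrite -RinvE -RplusE.
have e : INR k.+1 = (INR k.+2 * (1 + - / INR k.+2))%coqR.
  have nn : (INR k.+2 * / INR k.+2 = 1)%coqR by apply: Rinv_r; Lra.lra.
  have := S_INR k.+1; Lra.lra.
have q : (0 < 1 + - / INR k.+2)%coqR.
  have := p1; rewrite e => h; apply: (Rmult_lt_reg_l (INR k.+2)) => //; Lra.lra.
rewrite e ln_mult //.
have := exp_ineq1_le (ln (1 + - / INR k.+2)); rewrite exp_ln // => h; Lra.lra.
Qed.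

(** * Roots of unity and chord lengths *)

Section RootOfUnity.
Variable n : nat.
Hypothesis n_gt0 : (0 < n)%N.

Let nR_gt0 : (0 < INR n)%coqR. Proof. by apply: lt_0_INR; lia. Qed.
Definition unit_root : R[i] := Complex (cos (2 * PI / INR n)%coqR) (sin (2 * PI / INR n)%coqR).
Local Notation z := unit_root.

Lemma unit_rootX k :
  z ^+ k = Complex (cos (INR k * (2 * PI / INR n))%coqR) (sin (INR k * (2 * PI / INR n))%coqR).
Proof.
elim: k => [|k IH]; first by rewrite expr0 /= Rmult_0_l cos_0 sin_0.
rewrite exprS IH S_INR Rmult_plus_distr_r Rmult_1_l Rplus_comm cos_plus sin_plus.
apply/eqP; rewrite eq_complex /= !RealsE; apply/andP; split; apply/eqP; ring.
Qed.

(** The half-angle form of |1 - z^x|, for x < n. *)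
Definition chord (x : nat) : R := (2 * sin (INR x * (PI / INR n)))%coqR.

(** With y the distance from x to the nearer of 0 and n, the chord is at least y / n, by
    [sin_ge_quarter] and PI >= 2. Adding both reciprocals, instead of taking the larger, leads to
    two harmonic sums. *)
Lemma inv_chord_le (x : nat) : (0 < x < n)%N ->
  (chord x)^-1 <= n%:R * (x%:R^-1 + (n - x)%:R^-1).
Proof.
move=> /andP[x0 xn].
have half y : (0 < y)%coqR -> (y <= INR n / 2)%coqR ->
    (y / INR n <= 2 * sin (y * (PI / INR n)))%coqR.
  move=> y0 y2.
  have ni : (0 < / INR n)%coqR by apply: Rinv_0_lt_compat.
  have nn : (INR n * / INR n = 1)%coqR by apply: Rinv_r; Lra.lra.
  have yn : (y * / INR n <= / 2)%coqR by Lra.nra.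
  have yn0 : (0 < y * / INR n)%coqR by apply: Rmult_lt_0_compat.
  have := PI2_1 => pi1.
  have := @sin_ge_quarter (y * (PI / INR n))%coqR.
  have -> : (y * (PI / INR n) = (y * / INR n) * PI)%coqR by rewrite /Rdiv; Lra.lra.
  move=> h; have h1 : (0 <= y * / INR n * PI)%coqR by Lra.nra.
  have h2 : (y * / INR n * PI <= PI / 2)%coqR by Lra.nra.
  have := h h1 h2; rewrite /Rdiv; Lra.nra.
have inv_le y c : (0 < y)%coqR -> (y / INR n <= c)%coqR -> (/ c <= INR n * / y)%coqR.
  move=> y0 yc.
  have -> : (INR n * / y = / (y / INR n))%coqR.
    by rewrite Rinv_mult Rinv_inv; Lra.lra.
  apply: Rinv_le_contravar => //; exact: Rdiv_lt_0_compat.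
have xR : (0 < INR x)%coqR by apply: lt_0_INR; lia.
have nxR : (0 < INR (n - x))%coqR by apply: lt_0_INR; lia.
have e : INR (n - x) = (INR n - INR x)%coqR by apply: minus_INR; lia.
rewrite mulrDr -!INRE -!RinvE; apply/RleP; rewrite -RplusE -!RmultE.
have px : (0 < INR n * / INR x)%coqR by apply: Rmult_lt_0_compat => //; apply: Rinv_0_lt_compat.
have pnx : (0 < INR n * / INR (n - x))%coqR by apply: Rmult_lt_0_compat => //; apply: Rinv_0_lt_compat.
have [le|lt] := Rle_lt_dec (INR x) (INR n / 2)%coqR.
  have := inv_le _ _ xR (half _ xR le); rewrite /chord; Lra.lra.
have le : (INR (n - x) <= INR n / 2)%coqR by Lra.lra.
have := inv_le _ _ nxR (half _ nxR le).
have -> : (sin (INR (n - x) * (PI / INR n)) = sin (INR x * (PI / INR n)))%coqR.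
  rewrite e -[RHS]sin_PI_x; congr sin.
  rewrite Rmult_minus_distr_r; congr (_ - _)%coqR.
  by rewrite /Rdiv (Rmult_comm PI) -Rmult_assoc Rinv_r ?Rmult_1_l //; Lra.lra.
rewrite /chord; Lra.lra.
Qed.

Lemma chord_gt0 x : (0 < x < n)%N -> (0 < chord x)%coqR.
Proof.
move=> /andP[x0 xn]; rewrite /chord; apply: Rmult_lt_0_compat; first by Lra.lra.
have xR : (0 < INR x)%coqR by apply: lt_0_INR; lia.
have xnR : (INR x < INR n)%coqR by apply: lt_INR; lia.
have pi0 := PI_RGT_0.
have ni : (0 < / INR n)%coqR by apply: Rinv_0_lt_compat.
have nn : (INR n * / INR n = 1)%coqR by apply: Rinv_r; Lra.lra.
have xn1 : (INR x * / INR n < 1)%coqR by Lra.nra.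
have xn0 : (0 < INR x * / INR n)%coqR by Lra.nra.
have -> : (INR x * (PI / INR n) = (INR x * / INR n) * PI)%coqR by rewrite /Rdiv; Lra.lra.
apply: sin_gt_0; Lra.nra.
Qed.

Lemma norm_one_minus_unit_root x : (x < n)%N -> `|1 - z ^+ x| = real_complex R (chord x).
Proof.
move=> xn; rewrite normc_def unit_rootX /=; congr (real_complex R _).
have c0 : 0 <= chord x.
  case: x xn => [|x] xn; first by rewrite /chord Rmult_0_l sin_0 Rmult_0_r.
  by apply/RleP/Rlt_le; apply: chord_gt0; rewrite xn.
rewrite -[RHS](ger0_norm c0) -sqrtr_sqr; congr (Num.sqrt _).
have -> : (INR x * (2 * PI / INR n) = 2 * (INR x * (PI / INR n)))%coqR by rewrite /Rdiv; Lra.lra.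
rewrite /chord; set p := (INR x * _)%coqR.
rewrite cos_2a_sin sin_2a.
have := sin2_cos2 p; rewrite /Rsqr !RealsE => h.
set s := sin p in h *; set c := cos p in h *.
have hc : c * c = 1 - s * s by rewrite -h; ring.
have -> : (1 - (1 - (1 + 1) * s * s)) ^+ 2 + (0 - (1 + 1) * s * c) ^+ 2 =
  4 * s ^+ 4 + 4 * s ^+ 2 * (c * c) by ring.
by rewrite hc /=; ring.
Qed.

Lemma unit_root_primitive : n.-primitive_root z.
Proof.
apply/andP; split=> //; apply/forallP => i; apply/eqP.
rewrite unity_rootE.
have [e|ne] := eqVneq i.+1 n.
  rewrite e unit_rootX.
  have -> : (INR n * (2 * PI / INR n) = 2 * PI)%coqR.
    rewrite /Rdiv (Rmult_comm _ (/ _)) -Rmult_assoc Rinv_r; Lra.lra.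
  by rewrite cos_2PI sin_2PI; apply/eqP.
have lt : (i.+1 < n)%N by rewrite ltn_neqAle ne ltn_ord.
apply/negP => /eqP e.
have := norm_one_minus_unit_root lt; rewrite e subrr normr0 => /esym/eqP.
rewrite eq_complex /= => /andP[/eqP c0 _].
by have := @chord_gt0 i.+1; rewrite lt => /(_ isT); rewrite c0; apply: Rlt_irrefl.
Qed.

Lemma chord_sum_le :
  \sum_(x < n) (chord x)^-1 <= 2 * n%:R * (1 + ln n%:R).
Proof.
apply: (@le_trans _ _ (n%:R * (\sum_(x < n) x.+1%:R^-1 + \sum_(x < n) x.+1%:R^-1))); last first.
  have := harmonic_le_ln n.-1; rewrite prednK // => h.
  apply: le_trans (ler_wpM2l (ler0n _ _) (lerD h h)) _.
  by rewrite le_eqVlt; apply/orP; left; apply/eqP; ring.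
apply: (@le_trans _ _ (n%:R * (\sum_(x < n) x%:R^-1 + \sum_(x < n) (n - x)%:R^-1))).
  rewrite -big_split mulr_sumr; apply: ler_sum => x _ /=.
  have [e|x0] := eqVneq (x : nat) 0%N.
    rewrite e /chord Rmult_0_l sin_0 Rmult_0_r !RealsE invr0.
    by rewrite mulr_ge0 ?ler0n // add0r invr_ge0 ler0n.
  by apply: inv_chord_le; rewrite lt0n x0 ltn_ord.
apply: ler_wpM2l; first exact: ler0n.
apply: lerD.
  case: (n) => [|k]; first by rewrite !big_ord0.
  rewrite big_ord_recl invr0 add0r big_ord_recr /=.
  by rewrite lerDl invr_ge0 ler0n.
rewrite (reindex_inj rev_ord_inj) /=; apply: ler_sum => x _.
by rewrite subKn.
Qed.

End RootOfUnity.

Definition jacobi_shift (n r : nat) (a : nat) : R := IZR (jacobi (a + r) n).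

Lemma energy_real_complex (n : nat) (v : nat -> R) :
  energy n (fun a => real_complex R (v a)) = real_complex R (energy n v).
Proof.
rewrite /energy /conv rmorph_sum /=; apply: eq_bigr => s _.
rewrite rmorphXn rmorph_sum /=; congr (_ ^+ 2); apply: eq_bigr => i _.
by rewrite rmorphM.
Qed.

Lemma IZR_sqr_jacobi (n a : nat) : odd n -> squarefree n ->
  IZR (jacobi a n) ^+ 2 = (coprime a n)%:R :> R.
Proof.
move=> n_odd n_sqf; rewrite expr2 -RmultE -mult_IZR jacobi_sqr //.
by case: coprime.
Qed.

(** [energy_character] is applied in [R[i]]; all quantities there are images of reals, so the
    inequality descends to R. *)
Lemma energy_jacobi (n r : nat) : odd n -> squarefree n -> (1 < n)%N ->
  `|n%:R ^+ 2 * energy n (jacobi_shift n r) -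
     (n%:R ^+ 4 + 2 * n%:R * \sum_(a < n) (a%:R - (reflect_idx n r a)%:R) ^+ 2)| <=
  (noncoprimes n)%:R * (3 * n%:R ^+ 3 + 12 * n%:R * (2 * n%:R * (1 + ln n%:R)) ^+ 2) :> R.
Proof.
move=> n_odd n_sqf n_gt1; have n_gt0 := ltnW n_gt1.
pose chi a := real_complex R (IZR (jacobi a n)).
have chi_real a : (chi a)^* = chi a.
  by apply: conj_Creal; rewrite complex_real.
have chi_sqr a : chi a ^+ 2 = (coprime a n)%:R.
  by rewrite /chi -rmorphXn /= IZR_sqr_jacobi // rmorph_nat.
have chi_mod a : chi (a %% n)%N = chi a by rewrite /chi jacobi_mod.
have chiM a b : chi (a * b)%N = chi a * chi b.
  by rewrite /chi jacobiM // mult_IZR -rmorphM.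
have chi_prim p : prime p -> (p %| n)%N -> exists2 u, u = 1 %[mod n %/ p] & chi u = -1.
  move=> p_pr pn; have [u u1 ju] := jacobi_primitive n_odd n_sqf p_pr pn.
  by exists u => //; rewrite /chi ju -(rmorph1 (real_complex R)) -rmorphN.
have := energy_character (unit_root_primitive n_gt0) n_gt1 chi_mod chiM chi_sqr chi_real chi_prim r.
have -> : off_support n chi = real_complex R (noncoprimes n)%:R.
  rewrite /off_support /noncoprimes natr_sum rmorph_sum; apply: eq_bigr => a _ /=.
  by rewrite chi_sqr rmorph_nat; case: coprime; rewrite ?subrr ?subr0.
have -> : chord_sum n (unit_root n) = real_complex R (\sum_(x < n) (chord n x)^-1).
  rewrite /chord_sum rmorph_sum; apply: eq_bigr => x _ /=.
  by rewrite norm_one_minus_unit_root // fmorphV.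
rewrite (energy_real_complex n (jacobi_shift n r)).
have -> : \sum_(a < n) (a%:R - (reflect_idx n r a)%:R) ^+ 2 =
   real_complex R (\sum_(a < n) (a%:R - (reflect_idx n r a)%:R) ^+ 2).
  by rewrite rmorph_sum; apply: eq_bigr => a _; rewrite /= rmorphXn rmorphB /= !rmorph_nat.
set S := \sum_(a < n) _; set En := energy n _; set H := \sum_(x < n) _.
have -> : n%:R ^+ 2 * real_complex R En - (n%:R ^+ 4 + 2 * n%:R * real_complex R S) =
    real_complex R (n%:R ^+ 2 * En - (n%:R ^+ 4 + 2 * n%:R * S)).
  by rewrite !(rmorphB, rmorphD, rmorphM, rmorphXn, rmorph_nat).
have -> : real_complex R (noncoprimes n)%:R * (3 * n%:R ^+ 3 + 12 * n%:R * real_complex R H ^+ 2) =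
    real_complex R ((noncoprimes n)%:R * (3 * n%:R ^+ 3 + 12 * n%:R * H ^+ 2)).
  by rewrite !(rmorphD, rmorphM, rmorphXn, rmorph_nat).
rewrite normc_def /= expr0n /= addr0 sqrtr_sqr lecR => le.
apply: (le_trans le); apply: ler_wpM2l; first exact: ler0n.
rewrite lerD2l; apply: ler_wpM2l; first by rewrite mulr_ge0 ?ler0n.
have H0 : 0 <= H.
  apply: sumr_ge0 => x _; rewrite invr_ge0.
  by rewrite -(ler0c (chord n x)) -norm_one_minus_unit_root.
have HL : H <= 2 * n%:R * (1 + ln n%:R) := chord_sum_le n_gt0.
by apply: lerXn2r; rewrite ?nnegrE // (le_trans H0 HL).
Qed.

(** * The sum over the reflection *)

Lemma sum_ord_sqr (R : comPzRingType) (m : nat) :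
  6 * \sum_(a < m) a%:R ^+ 2 = m%:R * (m%:R - 1) * (2 * m%:R - 1) :> R.
Proof.
elim: m => [|m IH]; first by rewrite !big_ord0; ring.
by rewrite !big_ord_recr /= mulrDr IH -addn1 natrD; ring.
Qed.

Lemma sum_ord_threshold (R : pzRingType) (n k : nat) (x y : R) : (k <= n)%N ->
  \sum_(a < n) (if (a < k)%N then x else y) = k%:R * x + (n%:R - k%:R) * y.
Proof.
move=> le; rewrite -natrB // -[in LHS](subnKC le) big_split_ord /=.
rewrite (eq_bigr (fun=> x)) => [|i _]; last by rewrite ltn_ord.
rewrite [X in _ + X](eq_bigr (fun=> y)) => [|i _]; last by rewrite ltnNge leq_addr.
by rewrite !sumr_const !card_ord !mulr_natl.
Qed.

Section Reflection.
Variables (n r : nat).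
Hypothesis n_gt1 : (1 < n)%N.
Let n_gt0 : (0 < n)%N. Proof. exact: ltnW. Qed.
Local Notation s := (reflect_idx n r).

(** The sum is congruent to s 0 and lies in [0, 2 n), so it is s 0 or s 0 + n; as s a is in [0, n),
    the former holds exactly for a <= s 0. *)
Lemma reflect_idx_add a : (a < n)%N ->
  (s a + a = if a < (s 0).+1 then s 0 else s 0 + n)%N.
Proof.
move=> lt_a.
have s_lt b : (s b < n)%N by rewrite ltn_pmod.
have e : (s a + a = s 0 %[mod n])%N.
  rewrite /reflect_idx modn_mod modnDml mulnDr add0n addnAC.
  have -> : (n.-1 * a + a = a * n)%N by rewrite -{2}(prednK n_gt0) mulnS mulnC addnC.
  by rewrite modnMDl.
have sa := s_lt a; have s0 := s_lt 0%N.
rewrite (modn_small s0) in e.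
have [lt|ge] := ltnP (s a + a) n.
  rewrite modn_small // in e; rewrite e; case: ifP => //; lia.
have e2 : (s a + a = s 0 + n)%N.
  rewrite -(subnK ge); congr (_ + _)%N; rewrite -e -(subnK ge) modnDr modn_small; lia.
by rewrite e2; case: ifP => //; lia.
Qed.

(** Parallelogram identity: (a - s a)^2 + (a + s a)^2 = 2 a^2 + 2 (s a)^2, where a + s a takes at
    most two values and s permutes the residues. *)
Lemma sum_reflect_diff (R : comPzRingType) :
  \sum_(a < n) (a%:R - (s a)%:R) ^+ 2 =
  4 * \sum_(a < n) a%:R ^+ 2 -
   ((s 0)%:R + 1) * (s 0)%:R ^+ 2 - (n%:R - (s 0)%:R - 1) * ((s 0)%:R + n%:R) ^+ 2 :> R.
Proof.
have s_lt b : (s b < n)%N by rewrite ltn_pmod.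
have e : \sum_(a < n) ((s a)%:R + a%:R) ^+ 2 =
    ((s 0).+1%:R) * (s 0)%:R ^+ 2 + (n%:R - (s 0).+1%:R) * ((s 0)%:R + n%:R) ^+ 2 :> R.
  rewrite -sum_ord_threshold //; apply: eq_bigr => a _.
  by rewrite -natrD (reflect_idx_add (ltn_ord a)); case: ifP => // _; rewrite natrD.
have -> : 4 * \sum_(a < n) a%:R ^+ 2 = \sum_(a < n) (2 * a%:R ^+ 2) + \sum_(a < n) (2 * (s a)%:R ^+ 2) :> R.
  by rewrite -!mulr_sumr (sum_reflect_idx n_gt1 r (fun a => a%:R ^+ 2)); ring.
rewrite -[LHS](addrK (\sum_(a < n) ((s a)%:R + a%:R) ^+ 2)).
have -> : \sum_(a < n) (a%:R - (s a)%:R) ^+ 2 + \sum_(a < n) ((s a)%:R + a%:R) ^+ 2 =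
   \sum_(a < n) (2 * a%:R ^+ 2) + \sum_(a < n) (2 * (s a)%:R ^+ 2) :> R.
  by rewrite -!big_split /=; apply: eq_bigr => a _; ring.
by rewrite e -addn1 natrD; ring.
Qed.

Lemma sum_reflect_diff_asymp (F : realFieldType) :
  `|2 * (\sum_(a < n) (a%:R - (s a)%:R) ^+ 2) / n%:R ^+ 3 -
    (2 / 3 - 2 * ((s 0)%:R / n%:R) * (1 - (s 0)%:R / n%:R))| <= 4 / n%:R :> F.
Proof.
have n0 : n%:R != 0 :> F by rewrite pnatr_eq0 -lt0n.
have n1 : 1 <= n%:R :> F by rewrite ler1n.
have s_lt : (s 0 < n)%N by rewrite ltn_pmod.
have s1 : (s 0)%:R <= n%:R :> F by rewrite ler_nat ltnW.
have s0 : 0 <= (s 0)%:R :> F by rewrite ler0n.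
have S2 : \sum_(a < n) a%:R ^+ 2 = n%:R * (n%:R - 1) * (2 * n%:R - 1) / 6 :> F.
  by rewrite -sum_ord_sqr mulrC mulKf // pnatr_eq0.
rewrite sum_reflect_diff S2.
set t := (s 0)%:R in s0 s1 *; set N := n%:R in n0 n1 s1 *.
have -> : 2 * (4 * (N * (N - 1) * (2 * N - 1) / 6) - (t + 1) * t ^+ 2 - (N - t - 1) * (t + N) ^+ 2) / N ^+ 3
  - (2 / 3 - 2 * (t / N) * (1 - t / N)) = (4 * t / N - 2 + 4 / 3 / N) / N by field.
have i0 : 0 < N^-1 by rewrite invr_gt0; lra.
have i1 : N^-1 <= 1 by rewrite invf_le1; lra.
have tN : t / N <= 1 by rewrite ler_pdivrMr; lra.
have tN0 : 0 <= t / N by rewrite mulr_ge0 // ltW.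
rewrite normrM (gtr0_norm i0) ler_pM2r // ler_norml; apply/andP; split; lra.
Qed.

End Reflection.

(** * Rotation and the limit function *)

(** Extended from [0, 1] with period 1, x (1 - x) is even and Lipschitz. The ranges of x, y and d
    leave five values for k. *)
Lemma periodic_parabola_close (x y d : R) (k : Z) :
  (0 <= x <= 1 -> 0 <= y <= 1 -> Rabs d < 1 ->
   x = y + d + IZR k \/ x = - y + d + IZR k ->
   Rabs (x * (1 - x) - y * (1 - y)) <= 3 * Rabs d)%coqR.
Proof.
move=> [x0 x1] [y0 y1] d1.
have := Rle_abs d; have := Rle_abs (- d)%coqR; rewrite Rabs_Ropp; set D := Rabs d in d1 *.
move=> dl du.
have -> : (x * (1 - x) - y * (1 - y) = (x - y) * (1 - x - y))%coqR by Lra.lra.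
move=> h; apply: Rabs_le.
have kb : (-3 < k < 3)%coqZ.
  by split; apply: lt_IZR; case: h => h; Lra.lra.
have : (k = -2 \/ k = -1 \/ k = 0 \/ k = 1 \/ k = 2)%coqZ by lia.
case: h => h [e|[e|[e|[e|e]]]]; rewrite e in h; try (by exfalso; Lra.lra); split; Lra.nra.
Qed.

(** A natural representative of floor(n r) modulo n, as r may be negative. *)
Definition rot_shift (n : nat) (r : R) : nat :=
  Z.to_nat (Z.modulo (Zfloor (INR n * r)%coqR) (Z.of_nat n)).

Lemma Z_of_nat_modn (a n : nat) : (0 < n)%N ->
  Z.of_nat (a %% n)%N = Z.modulo (Z.of_nat a) (Z.of_nat n).
Proof.
move=> n_gt0; rewrite {2}(divn_eq a n) Nat2Z.inj_add Nat2Z.inj_mul Z.add_comm.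
by rewrite Z_mod_plus_full Z.mod_small //; have := ltn_pmod a n_gt0; lia.
Qed.

Lemma rot_index (n k : nat) (r : R) : (0 < n)%N ->
  Z.to_nat (Z.modulo (Z.of_nat k + Zfloor (INR n * r)%coqR) (Z.of_nat n)) =
  ((k + rot_shift n r) %% n)%N.
Proof.
move=> n_gt0; rewrite /rot_shift; set fl := Zfloor _.
have N0 : (0 < Z.of_nat n)%coqZ by lia.
have [m0 m1] := Z.mod_pos_bound fl _ N0.
rewrite -Zplus_mod_idemp_r -{1}(Z2Nat.id _ m0) -Nat2Z.inj_add.
by rewrite -Z_of_nat_modn // Nat2Z.id.
Qed.

Lemma rotE (n k : nat) (r : R) (a : nat -> R) : (k < n)%N ->
  Defs.rot n r a k = a ((k + rot_shift n r) %% n)%N.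
Proof. by move=> kn; rewrite /Defs.rot kn rot_index // (leq_trans _ kn). Qed.

(** [Jcoef] is 0 at index 0 by definition, and so is the symbol because n > 1; hence rotation is a
    plain shift of the symbol. *)
Lemma rot_Jcoef (n k : nat) (r : R) : odd n -> squarefree n -> (1 < n)%N -> (k < n)%N ->
  Defs.rot n r (Jcoef n) k = jacobi_shift n (rot_shift n r) k.
Proof.
move=> n_odd n_sqf n_gt1 kn; rewrite rotE // /jacobi_shift -(jacobi_mod n_odd n_sqf).
rewrite /Jcoef ltn_pmod ?(ltnW n_gt1) // andbT lt0n.
case: eqP => //= ->.
have := jacobi_sqr n_odd n_sqf 0; rewrite /coprime gcd0n (gtn_eqF n_gt1) => e.
by have -> : jacobi 0 n = 0%coqZ by lia.
Qed.

Lemma eq_conv (n : nat) (u v : nat -> R) s :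
  (forall k, (k < n)%N -> u k = v k) -> conv n u s = conv n v s.
Proof. by move=> uv; apply: eq_bigr => i _; rewrite !uv. Qed.

Lemma eq_energy (n : nat) (u v : nat -> R) :
  (forall k, (k < n)%N -> u k = v k) -> energy n u = energy n v.
Proof. by move=> uv; apply: eq_bigr => s _; rewrite (eq_conv _ uv). Qed.

Lemma rot_shift_coprime_sum (n r : nat) : (0 < n)%N ->
  (\sum_(i < n) ~~ coprime (i + r) n)%N = noncoprimes n.
Proof.
move=> n_gt0; rewrite /noncoprimes.
rewrite -(@sum_affine_mod _ n r 1 (fun a => nat_of_bool (~~ coprime a n))) ?coprime1n //.
  by apply: eq_bigr => i _; rewrite mul1n addnC.
by move=> a; rewrite coprime_modl.
Qed.

(** * The random coefficients *)

(** Negation in the coding of [code3], where 1 and 2 stand for 1 and -1. *)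
Definition neg3 (x : 'I_3) : 'I_3 := inord (if x == 0%N :> nat then 0 else 3 - x)%N.

Lemma neg3_val x : val (neg3 x) = (if x == 0%N :> nat then 0 else 3 - x)%N.
Proof. by rewrite /neg3 /= inordK //; case: x => [[|[|[|]]]]. Qed.

Lemma neg3K : involutive neg3.
Proof. by move=> x; apply: val_inj; rewrite !neg3_val; case: x => [[|[|[|]]]]. Qed.

Lemma code3_neg3 x : code3 (neg3 x) = - code3 x.
Proof.
rewrite /code3 neg3_val; case: x => [[|[|[|]]]] //= _; first by rewrite oppr0.
by rewrite (_ : (-1)%coqR = - (1 : R)) // opprK.
Qed.

Lemma code3_sqr x : code3 x ^+ 2 = (val x != 0%N)%:R.
Proof.
rewrite /code3; case: x => [[|[|[|]]]] //= _; first by rewrite expr0n.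
  by rewrite expr1n.
by rewrite (_ : (-1)%coqR = - (1 : R)) // sqrrN expr1n.
Qed.

Section Randomness.
Variables (n : nat) (r : R).
Hypothesis n_gt0 : (0 < n)%N.
Let r0 := rot_shift n r.
Let idx (k : nat) : 'I_n := Ordinal (ltn_pmod (k + r0) n_gt0).

Lemma rot_Vcoef (v : {ffun 'I_n -> 'I_3}) k : (k < n)%N ->
  Defs.rot n r (Vcoef v) k = code3 (v (idx k)).
Proof.
move=> kn; rewrite rotE // /Vcoef insubT /=; first by rewrite ltn_pmod.
by move=> p; congr (code3 (v _)); apply: val_inj.
Qed.

Lemma rot_Vcoef_sqr v k : v \in Vn n -> (k < n)%N ->
  Defs.rot n r (Vcoef v) k ^+ 2 = (~~ coprime (k + r0) n)%:R.
Proof.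
rewrite inE => /forallP/(_ (idx k))/eqP e kn.
by rewrite rot_Vcoef // code3_sqr e /= coprime_modl.
Qed.

(** The flip negates the single coefficient of v that rotation brings to place i; zeros stay zeros,
    so [Vn n] is preserved. *)
Lemma rot_Vcoef_flip i : (i < n)%N ->
  exists phi : {ffun 'I_n -> 'I_3} -> {ffun 'I_n -> 'I_3},
  [/\ injective phi, forall w, (phi w \in Vn n) = (w \in Vn n),
      forall w, Defs.rot n r (Vcoef (phi w)) i = - Defs.rot n r (Vcoef w) i &
      forall w j, (j < n)%N -> j != i -> Defs.rot n r (Vcoef (phi w)) j = Defs.rot n r (Vcoef w) j].
Proof.
move=> lt_i.
pose phi (w : {ffun 'I_n -> 'I_3}) := [ffun j => if j == idx i then neg3 (w j) else w j].
have phiK : involutive phi.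
  by move=> w; apply/ffunP => j; rewrite !ffunE; case: (j == idx i); rewrite ?neg3K.
exists phi; split=> [|w|w|w j lt_j ne].
- exact: inv_inj.
- rewrite !inE; apply: eq_forallb => j; rewrite ffunE; case: ifP => // _.
  rewrite neg3_val; congr (_ == _).
  by case: (w j) => [[|[|[|]]]].
- by rewrite !rot_Vcoef // ffunE eqxx code3_neg3.
rewrite !rot_Vcoef // ffunE; case: eqP => // /(congr1 val) /= /eqP.
by rewrite eqn_modDr !modn_small // (negPf ne).
Qed.

End Randomness.

Lemma red_bounds (r : R) : (- / 2 < red r <= / 2)%coqR.
Proof.
rewrite /red minus_IZR; have [h1 h2] := archimed (/ 2 - r)%coqR; split; Lra.lra.
Qed.

(** This is the main term of [sum_reflect_diff_asymp] with s 0 / n replaced by 2 |red r|. *)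
Lemma inv_f (r : R) : (/ Defs.f r = 2 / 3 - 2 * (2 * Rabs (red r) * (1 - 2 * Rabs (red r))))%coqR.
Proof. by rewrite /Defs.f Rinv_inv; Lra.lra. Qed.

(** s 0 is - 2 floor(n r) modulo n, so d is twice the fractional part of n r, divided by n. *)
Lemma reflect_idx0_real (n : nat) (r : R) : (1 < n)%N ->
  exists k : Z, exists d : R,
  (0 <= d <= 2 / INR n /\
   INR (reflect_idx n (rot_shift n r) 0) / INR n = - (2 * red r) + d + IZR k)%coqR.
Proof.
move=> n_gt1.
have n_gt0 := ltnW n_gt1.
have N0 : (0 < INR n)%coqR by apply: lt_0_INR; lia.
set r0 := rot_shift n r; set s0 := reflect_idx n r0 0.
have [k1 e1] : exists k1, (s0 + 2 * r0 = k1 * n)%N.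
  apply/dvdnP; rewrite /dvdn /s0 /reflect_idx add0n modnDml.
  by rewrite -{2}[(2 * r0)%N]mul1n -mulnDl addn1 prednK // modnMr.
set fl := Zfloor (INR n * r)%coqR.
have [h1 h2] := archimed (INR n * r)%coqR.
have fl1 : IZR fl = (IZR (up (INR n * r)) - 1)%coqR by rewrite /fl /Zfloor minus_IZR.
pose k2 := Z.div fl (Z.of_nat n).
have e2 : INR r0 = (IZR fl - INR n * IZR k2)%coqR.
  have nz : Z.of_nat n <> 0%coqZ by lia.
  have [m0 _] := Z.mod_pos_bound fl (Z.of_nat n) ltac:(lia).
  rewrite /r0 /rot_shift INR_IZR_INZ -/fl Z2Nat.id // Z.mod_eq // minus_IZR mult_IZR.
  by rewrite -INR_IZR_INZ.
have e3 : (INR s0 + 2 * INR r0 = INR k1 * INR n)%coqR.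
  have -> : 2%coqR = INR 2 by rewrite /=; Lra.lra.
  by rewrite -!mult_INR -plus_INR; exact: (congr1 INR e1).
clearbody k2 fl.
exists (Z.of_nat k1 + 2 * k2 - 2 * (1 - up (/ 2 - r)))%coqZ.
exists (2 * (INR n * r - IZR fl) / INR n)%coqR.
have ni : (0 < / INR n)%coqR by apply: Rinv_0_lt_compat.
have nn : (INR n * / INR n = 1)%coqR by apply: Rinv_r; Lra.lra.
split.
  rewrite /Rdiv; split; first by apply: Rmult_le_pos; Lra.lra.
  by apply: Rmult_le_compat_r; Lra.lra.
rewrite !minus_IZR plus_IZR !mult_IZR minus_IZR -INR_IZR_INZ /red minus_IZR.
have -> : INR s0 = (INR k1 * INR n - 2 * (IZR fl - INR n * IZR k2))%coqR by Lra.lra.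
rewrite /Rdiv.
set i := (/ INR n)%coqR in nn ni *; set N := INR n in nn *.
have -> : ((INR k1 * N - 2 * (IZR fl - N * IZR k2)) * i =
  INR k1 * (N * i) - 2 * IZR fl * i + 2 * IZR k2 * (N * i))%coqR by Lra.lra.
have -> : (2 * (N * r - IZR fl) * i = 2 * r * (N * i) - 2 * IZR fl * i)%coqR by Lra.lra.
rewrite nn; Lra.lra.
Qed.

(** 51 is 3 + 48, from 3 and 12 times 2^2 in [energy_jacobi], as (1 + ln n)^2 >= 1. 16 is 4 + 2
    times 6: 4 / n from [sum_reflect_diff_asymp], and 3 d <= 6 / n from replacing s 0 / n. *)
Lemma energy_rot_Jcoef (n : nat) (r : R) : odd n -> squarefree n -> (1 < n)%N ->
  `|energy n (Defs.rot n r (Jcoef n)) / n%:R ^+ 2 - (1 + (Defs.f r)^-1)| <=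
  51 * (1 + ln n%:R) ^+ 2 * ((noncoprimes n)%:R / n%:R) + 16 / n%:R :> R.
Proof.
move=> n_odd n_sqf n_gt1.
have n_gt0 := ltnW n_gt1.
set r0 := rot_shift n r.
rewrite (@eq_energy n _ (jacobi_shift n r0)); last by move=> k kn; rewrite rot_Jcoef.
have h1 := energy_jacobi r0 n_odd n_sqf n_gt1.
have h2 := @sum_reflect_diff_asymp n r0 n_gt1 R.
set E := energy n _ in h1 *.
set S := \sum_(a < n) _ in h1 h2.
set m := (noncoprimes n)%:R in h1 *.
have m0 : 0 <= m by rewrite ler0n.
set s0 := reflect_idx n r0 0 in h2.
have N1 : 2 <= n%:R :> R by rewrite (ler_nat R 2).
have L1 : 1 <= 1 + ln n%:R :> R.
  rewrite lerDl; apply/RleP; rewrite -R0E -ln_1; apply: ln_le; first exact: Rlt_0_1.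
  by apply/RleP; apply: le_trans N1; rewrite R1E; lra.
set L := 1 + ln n%:R in L1 h1 *.
have h3 : `|(s0%:R / n%:R) * (1 - s0%:R / n%:R) -
    (2 * Rabs (red r)) * (1 - 2 * Rabs (red r))| <= 6 / n%:R :> R.
  have [k [d [[d0 d1] e]]] := reflect_idx0_real r n_gt1.
  have [rl ru] := red_bounds r.
  have s_lt : (s0 < n)%N by rewrite ltn_pmod.
  have N0 : (0 < INR n)%coqR by apply: lt_0_INR; lia.
  (* As n is odd, n >= 3, so d <= 2 / 3 < 1 as [periodic_parabola_close] asks. *)
  have N3 : (3 <= INR n)%coqR.
    rewrite (_ : 3%coqR = INR 3); last by rewrite /=; Lra.lra.
    by apply: le_INR; case: (n) n_gt1 n_odd => [|[|[|]]] //; lia.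
  have ni : (0 < / INR n)%coqR by apply: Rinv_0_lt_compat.
  have nn : (INR n * / INR n = 1)%coqR by apply: Rinv_r; Lra.lra.
  have sr : (0 <= INR s0 <= INR n)%coqR by split; [apply: pos_INR | apply: le_INR; lia].
  have Rr := Rabs_pos (red r).
  have Rr2 : (Rabs (red r) <= / 2)%coqR by apply: Rabs_le; Lra.lra.
  have := @periodic_parabola_close (INR s0 / INR n)%coqR (2 * Rabs (red r))%coqR d k.
  have -> : Rabs d = d by apply: Rabs_pos_eq.
  rewrite /Rdiv in d1 *.
  have b1 : (0 <= INR s0 * / INR n <= 1)%coqR by Lra.nra.
  have b2 : (0 <= 2 * Rabs (red r) <= 1)%coqR by Lra.lra.
  have b3 : (d < 1)%coqR by Lra.nra.
  have b4 : (INR s0 * / INR n = 2 * Rabs (red r) + d + IZR k \/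
             INR s0 * / INR n = - (2 * Rabs (red r)) + d + IZR k)%coqR.
    rewrite /Rdiv in e; rewrite e.
    have [rp|rn] := Rle_lt_dec 0 (red r).
      by right; rewrite Rabs_pos_eq.
    by left; rewrite Rabs_left // ; Lra.lra.
  move=> /(_ b1 b2 b3 b4) h.
  have h' : (Rabs (INR s0 * / INR n * (1 - INR s0 * / INR n) -
       2 * Rabs (red r) * (1 - 2 * Rabs (red r))) <= 6 * / INR n)%coqR by Lra.lra.
  by move/RleP: h'; rewrite !RealsE.
have eF : (Defs.f r)^-1 = 2 / 3 - 2 * ((2 * Rabs (red r)) * (1 - 2 * Rabs (red r))) :> R.
  by rewrite -RinvE inv_f !RealsE.
rewrite eF.
set q := (2 * Rabs (red r)) * _ in h3 *.
set x := s0%:R / n%:R in h2 h3.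
set N := n%:R in N1 h1 h2 h3 *.
have N0 : 0 < N by lra.
have h1' : `|E / N ^+ 2 - (1 + 2 * S / N ^+ 3)| <= 51 * L ^+ 2 * (m / N).
  have -> : E / N ^+ 2 - (1 + 2 * S / N ^+ 3) = (N ^+ 2 * E - (N ^+ 4 + 2 * N * S)) / N ^+ 4.
    by field; rewrite gt_eqF.
  have N4 : `|N ^+ 4| = N ^+ 4 by rewrite ger0_norm // exprn_ge0 // ltW.
  rewrite normrM normfV N4 ler_pdivrMr ?exprn_gt0 //; apply: (le_trans h1).
  have -> : 51 * L ^+ 2 * (m / N) * N ^+ 4 = m * (51 * L ^+ 2 * N ^+ 3).
    by field; rewrite gt_eqF.
  apply: ler_wpM2l => //.
  have -> : 3 * N ^+ 3 + 12 * N * (2 * N * L) ^+ 2 = (3 + 48 * L ^+ 2) * N ^+ 3 by ring.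
  rewrite ler_pM2r ?exprn_gt0 //; nra.
have i0 : 0 < N^-1 by rewrite invr_gt0.
move: h1' h2 h3; rewrite !ler_norml => /andP[a1 a2] /andP[b1 b2] /andP[c1 c2].
apply/andP; split; lra.
Qed.

(** * Deviation of the merit factor *)

Lemma inv_f_bounds (r : R) : (/ 6 <= / Defs.f r <= 2 / 3)%coqR.
Proof.
have [h1 h2] := red_bounds r.
have a0 := Rabs_pos (red r).
have a1 : (Rabs (red r) <= / 2)%coqR by apply: Rabs_le; Lra.lra.
rewrite inv_f; split; last by Lra.nra.
have := pow2_ge_0 (Rabs (red r) - / 4)%coqR; Lra.nra.
Qed.

(** 72 = 12 times 6, because x >= 1/12 and l >= 1/6. *)
Lemma inverse_close (F : realFieldType) (x l eta : F) :
  6^-1 <= l -> eta <= 12^-1 -> `|x - l| <= eta -> `|x^-1 - l^-1| <= 72 * eta.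
Proof.
move=> l6 e12; rewrite ler_norml => /andP[x1 x2].
have l0 : 0 < l by lra.
have x0 : 12^-1 <= x by lra.
have xp : 0 < x by lra.
have -> : x^-1 - l^-1 = (l - x) / (x * l) by field; rewrite !gt_eqF.
have xl : 72^-1 <= x * l by nra.
have xlp : 0 < x * l by rewrite mulr_gt0.
rewrite normrM normfV (gtr0_norm xlp) ler_pdivrMr //.
apply: (@le_trans _ _ eta); first by rewrite ler_norml; lra.
have e0 : 0 <= eta by lra.
nra.
Qed.

Section Deviation.
Variables (n : nat) (r : R).
Hypotheses (n_odd : odd n) (n_sqf : squarefree n) (n_gt1 : (1 < n)%N).
Let n_gt0 : (0 < n)%N. Proof. exact: ltnW. Qed.
Local Notation J := (Defs.rot n r (Jcoef n)).
Local Notation V v := (Defs.rot n r (Vcoef v)).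
Local Notation N := (n%:R : R).
Local Notation m := ((noncoprimes n)%:R : R).

Lemma rot_Jcoef_sqr k : (k < n)%N -> J k ^+ 2 = (coprime (k + rot_shift n r) n)%:R.
Proof. by move=> kn; rewrite rot_Jcoef // /jacobi_shift IZR_sqr_jacobi. Qed.

Lemma sum_coefs_sqr v k : v \in Vn n -> (k < n)%N -> (J k + V v k) ^+ 2 = 1.
Proof.
move=> vV kn; have := rot_Jcoef_sqr kn; have := rot_Vcoef_sqr r n_gt0 vV kn.
case: coprime => /= /eqP + /eqP.
  by rewrite sqrf_eq0 => /eqP -> /eqP; rewrite addr0.
by move=> + ; rewrite sqrf_eq0 => /eqP + /eqP -> ; rewrite add0r.
Qed.

Lemma merit_sum v : v \in Vn n ->
  merit n (fun k => J k + V v k)%coqR = (energy n (fun k => J k + V v k) / N ^+ 2 - 1)^-1.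
Proof.
move=> vV; rewrite /merit Lpow4 Lpow2.
rewrite (eq_bigr (fun=> 1)) => [|k _]; last by apply: sum_coefs_sqr.
rewrite sumr_const card_ord !RealsE; set E := energy n _.
have n0 : N != 0 by rewrite pnatr_eq0 -lt0n.
have -> : E / N ^+ 2 - 1 = (E - N ^+ 2) / N ^+ 2 by field.
by rewrite invf_div.
Qed.

Definition perturbation (v : {ffun 'I_n -> 'I_3}) : R :=
  \sum_(s < n.*2) (conv n (fun k => J k + V v k) s - conv n J s) ^+ 2.

Lemma sum_perturbation :
  \sum_(v in Vn n) perturbation v <= #|Vn n|%:R * (20 * N * m).
Proof.
have -> : noncoprimes n = support_size n (fun k => ~~ coprime (k + rot_shift n r) n).
  by rewrite -(rot_shift_coprime_sum (rot_shift n r) n_gt0).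
apply: (@expected_perturbation R n _ (Vn n) (fun v k => V v k)).
- by move=> i lt_i; apply: rot_Vcoef_flip.
- by move=> w i wV lt_i; apply: rot_Vcoef_sqr.
move=> i; case: (ltnP i n) => lt_i; first by rewrite rot_Jcoef_sqr // lern1 leq_b1.
by rewrite /Defs.rot ltnNge lt_i /= expr0n /= ler01.
Qed.

Lemma perturbation_ge0 v : 0 <= perturbation v.
Proof. by apply: sumr_ge0 => s _; apply: sqr_ge0. Qed.

(** Half of eta pays for the energy of J_r, a quarter for e EJ <= 2 e N^2, a quarter for the
    perturbation; [inverse_close] contributes the factor 72. *)
Lemma merit_close (eta e th : R) v : v \in Vn n ->
  0 < eta -> eta <= 12^-1 -> 0 < e -> e <= eta / 8 -> (1 + e^-1) * th <= eta / 4 ->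
  51 * (1 + ln N) ^+ 2 * (m / N) + 16 / N <= eta / 2 ->
  perturbation v <= th * N ^+ 2 ->
  `|merit n (fun k => J k + V v k)%coqR - Defs.f r| <= 72 * eta.
Proof.
move=> vV eta0 eta12 e0 e8 th4 det pv.
have N0 : 0 < N by rewrite ltr0n.
have N20 : 0 < N ^+ 2 by rewrite exprn_gt0.
have h1 := energy_rot_Jcoef r n_odd n_sqf n_gt1.
have h2 := energy_perturbation n J (fun k => J k + V v k) e0.
rewrite -/(perturbation v) in h2.
have [/RleP l6 /RleP l3] := inv_f_bounds r; rewrite !RealsE /= in l6 l3.
rewrite merit_sum // -[Defs.f r]invrK; apply: inverse_close => //.
set EV := energy n _ in h2 *; set EJ := energy n J in h1 h2.
set l := (Defs.f r)^-1 in h1 l6 l3 *.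
have {}h1 : `|EJ / N ^+ 2 - (1 + l)| <= eta / 2 by apply: le_trans h1 det.
(* 1 + l is at most 5/3, and eta / 2 at most 1/24. *)
have EJ2 : EJ / N ^+ 2 <= 2 by move: h1; rewrite ler_norml => /andP[_ h]; lra.
have h3 : `|EV / N ^+ 2 - EJ / N ^+ 2| <= eta / 2.
  rewrite -mulrBl normrM normfV (gtr0_norm N20) ler_pdivrMr //.
  apply: (le_trans h2).
  have EJle : EJ <= 2 * N ^+ 2 by rewrite -ler_pdivrMr.
  have ei : 0 < 1 + e^-1 by rewrite addr_gt0 ?invr_gt0.
  have a1 : e * EJ <= eta / 8 * (2 * N ^+ 2).
    apply: (@le_trans _ _ (e * (2 * N ^+ 2))); first by rewrite ler_pM2l.
    by rewrite ler_wpM2r // mulr_ge0 ?ltW.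
  have a2 : (1 + e^-1) * perturbation v <= eta / 4 * N ^+ 2.
    apply: (@le_trans _ _ ((1 + e^-1) * (th * N ^+ 2))); first by rewrite ler_pM2l.
    by rewrite mulrA ler_wpM2r // ltW.
  lra.
move: h1 h3; rewrite !ler_norml => /andP[a1 a2] /andP[b1 b2]; apply/andP; split; lra.
Qed.

(** Markov's inequality by counting: each bad v has perturbation at least th N^2, while the average
    over [Vn n] is at most 20 N m. *)
Lemma prob_dev_le (eps eta e th : R) :
  0 < eta -> eta <= 12^-1 -> 72 * eta <= eps -> 0 < e -> e <= eta / 8 ->
  0 < th -> (1 + e^-1) * th <= eta / 4 ->
  51 * (1 + ln N) ^+ 2 * (m / N) + 16 / N <= eta / 2 ->
  prob_dev n r eps <= 20 / th * (m / N).
Proof.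
move=> eta0 eta12 eps72 e0 e8 th0 th4 det.
have N0 : 0 < N by rewrite ltr0n.
rewrite /prob_dev !RealsE; set bad := [set v in _ | _].
have badP v : v \in bad -> v \in Vn n /\ th * N ^+ 2 <= perturbation v.
  rewrite inE => /andP[vV]; case: Rlt_dec => //= lt _; split=> //.
  rewrite leNgt; apply/negP => /ltW pv.
  have := merit_close vV eta0 eta12 e0 e8 th4 det pv.
  move=> h; have := le_trans h eps72.
  by move/RleP; rewrite -!RealsE => h'; apply: (Rlt_irrefl eps); apply: Rlt_le_trans lt h'.
have mk : #|bad|%:R * (th * N ^+ 2) <= #|Vn n|%:R * (20 * N * m).
  apply: le_trans sum_perturbation.
  rewrite mulr_natl -sumr_const.
  rewrite [leRHS](bigID (mem bad)) /=.
  rewrite -[leLHS]addr0 lerD //; last by apply: sumr_ge0 => v _; apply: perturbation_ge0.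
  have -> : \sum_(v in Vn n | v \in bad) perturbation v = \sum_(v in bad) perturbation v.
    apply: eq_bigl => v; rewrite andbC.
    by case: (boolP (v \in bad)) => // /badP[->].
  by apply: ler_sum => v /badP[].
have rhs0 : 0 <= 20 / th * (m / N) by rewrite !mulr_ge0 ?invr_ge0 ?ler0n // ltW.
(* For an empty sample space the quotient is 0, by 0^-1 = 0. *)
have [->|Vn0] := eqVneq #|Vn n| 0%N; first by rewrite invr0 mulr0.
have Vp : 0 < #|Vn n|%:R :> R by rewrite ltr0n lt0n.
rewrite ler_pdivrMr //.
have -> : 20 / th * (m / N) * #|Vn n|%:R = #|Vn n|%:R * (20 * N * m) / (th * N ^+ 2).
  by field; rewrite !gt_eqF.
by rewrite ler_pdivlMr // mulr_gt0 ?exprn_gt0.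
Qed.

End Deviation.

(** * Convergence in probability *)

(** With omega(n) prime factors, n - phi(n) <= omega(n) n / p_n, and omega(n) <= log2 n <= 2 ln n
    because ln 2 > 1/2. *)
Lemma noncoprimes_ratio_le (n : nat) : (1 < n)%N ->
  (INR (noncoprimes n) / INR n <= 2 * ln (INR n) / INR (pdiv n))%coqR.
Proof.
move=> n_gt1; have n_gt0 := ltnW n_gt1.
have N0 : (0 < INR n)%coqR by apply: lt_0_INR; lia.
have p0 : (0 < INR (pdiv n))%coqR by apply: lt_0_INR; have := pdiv_gt0 n; lia.
have h1 : (INR (noncoprimes n) * INR (pdiv n) <= INR (size (primes n)) * INR n)%coqR.
  by rewrite -!mult_INR; apply: le_INR; apply/ssrnat.leP; apply: noncoprimes_le.
have ln2X k : (INR k * ln 2 = ln (INR (2 ^ k)))%coqR.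
  elim: k => [|k IH]; first by rewrite /= Rmult_0_l ln_1.
  rewrite S_INR expnS mult_INR ln_mult.
  - by rewrite -IH /= (_ : (1 + 1 = 2)%coqR) //; Lra.lra.
  - by rewrite /=; Lra.lra.
  - by apply: lt_0_INR; apply/ssrnat.ltP; rewrite expn_gt0.
have h2 : (INR (size (primes n)) * ln 2 <= ln (INR n))%coqR.
  rewrite ln2X; apply: ln_le.
    by apply: lt_0_INR; apply/ssrnat.ltP; rewrite expn_gt0.
  by apply: le_INR; apply/ssrnat.leP; apply: expn2_size_primes.
have h3 : (INR (size (primes n)) <= 2 * ln (INR n))%coqR.
  have := ln_lt_2; have := pos_INR (size (primes n)); Lra.nra.
apply/Rle_div_l => //.
have -> : (2 * ln (INR n) / INR (pdiv n) * INR n = (2 * ln (INR n) * INR n) / INR (pdiv n))%coqR.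
  by rewrite /Rdiv; Lra.lra.
apply/Rle_div_r => //; apply: (Rle_trans _ _ _ h1).
by apply: Rmult_le_compat_r => //; Lra.lra.
Qed.

Local Close Scope ring_scope.
Local Open Scope R_scope.

Theorem theorem5 (S : nat -> Prop) (r : R) :
  (forall n, S n -> odd n /\ squarefree n /\ (1 < n)%N) ->
  (forall N : nat, exists n, S n /\ (N <= n)%N) ->
  (forall e : R, (0 < e) -> exists N : nat, forall n, S n -> (N <= n)%N ->
      (Rabs (ln (INR n) ^ 7 / INR (pdiv n)) < e)) ->
  forall eps delta : R, (0 < eps) -> (0 < delta) ->
    exists N : nat, forall n, S n -> (N <= n)%N -> (prob_dev n r eps < delta).
Proof.
move=> hS _ hlim eps delta eps0 delta0.
pose eta := Rmin (/ 12) (eps / 72).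
have eta0 : 0 < eta by apply: Rmin_glb_lt; Lra.lra.
have eta12 : eta <= / 12 by apply: Rmin_l.
have eta_eps : 72 * eta <= eps by have := Rmin_r (/ 12) (eps / 72); rewrite -/eta; Lra.lra.
pose e := eta / 8.
have e0 : 0 < e by rewrite /e; Lra.lra.
have ei : 0 < 1 + / e by have := Rinv_0_lt_compat e e0; Lra.lra.
pose th := eta / 4 / (1 + / e).
have th0 : 0 < th by apply: Rdiv_lt_0_compat; Lra.lra.
have th4 : (1 + / e) * th = eta / 4.
  by rewrite /th /Rdiv Rmult_comm Rmult_assoc Rinv_l ?Rmult_1_r //; Lra.lra.
(* 1632 = 4 times 408 brings the error 408 l^3 / p_n, with l = ln n, below eta / 4; the second bound
   brings the Markov estimate 40 l / (th p_n) below delta. *)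
pose e1 := Rmin (eta / 1632) (delta * th / 40).
have e10 : 0 < e1.
  by apply: Rmin_glb_lt; [Lra.lra | apply: Rdiv_lt_0_compat; [apply: Rmult_lt_0_compat | Lra.lra]].
have [N1 hN1] := hlim e1 e10.
(* From 64 / eta on, 16 / n is at most eta / 4. *)
pose N2 := Z.to_nat (up (64 / eta)).
(* n >= 3 ensures ln n >= 1, so that l and l^3 are at most l^7. *)
exists (maxn N1 (maxn N2 3)) => n Sn; rewrite !geq_max => /andP[n1 /andP[n2 n3]].
have [n_odd [n_sqf n_gt1]] := hS n Sn.
have N3 : 3 <= INR n by rewrite (_ : 3 = INR 3); [apply: le_INR; apply/ssrnat.leP | rewrite /=; Lra.lra].
have hA := hN1 n Sn n1.
set l := ln (INR n) in hA.
have l1 : 1 <= l.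
  rewrite -(ln_exp 1); apply: ln_le; first exact: exp_pos.
  by have := exp_le_3; Lra.lra.
have p0 : 0 < INR (pdiv n) by apply: lt_0_INR; apply/ssrnat.ltP; apply: pdiv_gt0.
set ip := / INR (pdiv n).
have ip0 : 0 < ip by apply: Rinv_0_lt_compat.
have powle k : (k <= 7)%N -> l ^ k * ip <= l ^ 7 * ip.
  by move=> k7; apply: Rmult_le_compat_r; [Lra.lra | apply: Rle_pow => //; apply/ssrnat.leP].
have A_lt : l ^ 7 * ip < e1.
  by apply: Rle_lt_trans hA; apply: Rle_abs.
have A1 : l ^ 7 * ip < eta / 1632 by apply: Rlt_le_trans A_lt _; apply: Rmin_l.
have A2 : l ^ 7 * ip < delta * th / 40 by apply: Rlt_le_trans A_lt _; apply: Rmin_r.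
have q := noncoprimes_ratio_le n_gt1; rewrite -/l in q.
set q0 := INR (noncoprimes n) / INR n in q.
have q00 : 0 <= q0.
  by apply: Rmult_le_pos; [apply: pos_INR | apply: Rlt_le; apply: Rinv_0_lt_compat; Lra.lra].
have {}q : q0 <= 2 * (l * ip) by rewrite /ip; rewrite /Rdiv in q; Lra.lra.
have det : 51 * (1 + l) ^ 2 * q0 + 16 / INR n <= eta / 2.
  have t1 : (1 + l) ^ 2 <= 4 * l ^ 2 by Lra.nra.
  have t2 : 51 * (1 + l) ^ 2 * q0 <= 408 * (l ^ 3 * ip).
    apply: (Rle_trans _ (51 * (4 * l ^ 2) * (2 * (l * ip)))); last by Lra.lra.
    by apply: Rmult_le_compat => //; Lra.nra.
  have t3 : 16 / INR n <= eta / 4.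
    apply/Rle_div_l; first by Lra.lra.
    have [u1 _] := archimed (64 / eta).
    have u2 : IZR (up (64 / eta)) <= INR n.
      have u3 : 0 < 64 / eta by apply: Rdiv_lt_0_compat; Lra.lra.
      have u4 : (0 < up (64 / eta))%coqZ by apply: lt_IZR; Lra.lra.
      by rewrite INR_IZR_INZ; apply: IZR_le; move: n2; rewrite /N2; lia.
    have u5 : 64 / eta <= INR n by Lra.lra.
    have : 64 <= INR n * eta by apply/Rle_div_l.
    Lra.lra.
  have := powle 3%N isT; Lra.lra.
have main : prob_dev n r eps <= 20 / th * q0.
  apply/RleP; rewrite /q0 !RealsE.
  apply: (@prob_dev_le n r n_odd n_sqf n_gt1 eps eta e th).
  - by apply/RltP.
  - by apply/RleP; move: eta12; rewrite !RealsE.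
  - by apply/RleP; move: eta_eps; rewrite !RealsE.
  - by apply/RltP.
  - by rewrite /e !RealsE.
  - by apply/RltP.
  - by apply/RleP; move: th4; rewrite !RealsE => ->; apply: Rle_refl.
  - by apply/RleP; move: det; rewrite /q0 /l !RealsE.
apply: Rle_lt_trans main _.
apply: (Rle_lt_trans _ (20 / th * (2 * (l * ip)))).
  by apply: Rmult_le_compat_l => //; apply: Rlt_le; apply: Rdiv_lt_0_compat; Lra.lra.
have := powle 1%N isT; rewrite pow_1 => h.
apply: (Rmult_lt_reg_l th) => //.
have -> : th * (20 / th * (2 * (l * ip))) = (th * / th) * 40 * (l * ip) by rewrite /Rdiv; Lra.lra.
by rewrite Rinv_r; Lra.lra.
Qed.
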